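(* (i) There is a (sufficiently small) absolute constant $c>0$ such that $$\sum_{k\le N}\widetilde{\mathfrak S}_y(k)^2\asymp\frac{N}{y^2}\qquad\text{for all real } N,y \text{ with } 1\le y\le c\sqrt N,$$ with absolute implied constants. (ii) For every fixed $\delta$ with $0<\delta<1$ and all real $N,y$ with $1\le y\le\sqrt N$, $$\sum_{k\le N}\widetilde{\mathfrak S}_y(k)^2=\mathcal T(y)\,N\left(1+O_\delta\!\left(\Big(\frac{y^2}{N}\Big)^{\delta/4}\right)\right),$$ where $\mathcal T(y)=\sum_{q>y}\frac{\mu(q)^2}{\phi(q)^3}$, and the implied constant depends only on $\delta$.
   Context: Sums over $k$ and $q$ run over positive integers; in particular $\sum_{k\le N}$ means $\sum_{1\le k\le N}$. $f\asymp g$ means $f\ll g$ and $g\ll f$. $\mu$ is the Möbius function and $\phi$ is Euler's totient function. The Ramanujan sum is $c_q(n)=\sum_{1\le a\le q,\ (a,q)=1}e^{2\pi i an/q}$. For a positive integer $k$ and real $y\ge1$, the tail of the singular series is $$\widetilde{\mathfrak S}_y(k)=\sum_{q>y}\frac{\mu(q)^2}{\phi(q)^2}\,c_q(-k).$$ *)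

(* Defs.v *)
From mathcomp Require Import all_boot all_order all_algebra.
From mathcomp Require Import all_classical all_reals all_analysis.
From mathcomp Require Export complex.

Set Implicit Arguments.
Unset Strict Implicit.
Unset Printing Implicit Defensive.

Import Order.TTheory GRing.Theory Num.Theory.
Import numFieldNormedType.Exports.

Local Open Scope ring_scope.
Local Open Scope complex_scope.

Definition squarefree (n : nat) : bool :=
  (0 < n)%N && all (fun p => ~~ (p ^ 2 %| n)%N) (primes n).

Definition moebius (n : nat) : int :=
  if squarefree n then (-1) ^+ size (primes n) else 0.

Definition expi (R : realType) (t : R) : R[i] := cos t +i* sin t.

Definition ramanujan_sum (R : realType) (q : nat) (n : int) : R[i] :=
  \sum_(1 <= a < q.+1 | coprime a q)
     expi (2 * pi * a%:R * n%:~R / q%:R).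

Lemma sinB2pi_int (R : realType) (t : R) (n : int) :
  sin (2 * pi * n%:~R - t) = - sin t.
Proof.
have per m (u : R) : sin (u + 2 * pi * m%:R) = sin u.
  elim: m => [|m IH]; first by rewrite mulr0 addr0.
  have -> : u + 2 * pi * m.+1%:R = u + 2 * pi * m%:R + pi *+ 2.
    by rewrite -[m.+1]addn1 natrD (mulrDr (2 * pi)) mulr1 addrA -[pi *+ 2]mulr_natl.
  by rewrite sinD2pi.
case: n => m.
  by rewrite addrC per sinN.
by rewrite NegzE mulrNz mulrN -opprD sinN [_ + t]addrC per.
Qed.

(* The terms indexed by a and q - a are complex conjugate. *)
Lemma ramanujan_sum_real (R : realType) (q : nat) (n : int) :
  (complex.Re (ramanujan_sum R q n))%:C = ramanujan_sum R q n.
Proof.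
suff im0 : complex.Im (ramanujan_sum R q n) = 0.
  by rewrite [RHS]complexE im0 mulr0 addr0.
pose s a : R := sin (2 * pi * a%:R * n%:~R / q%:R).
have -> : complex.Im (ramanujan_sum R q n) = \sum_(1 <= a < q.+1 | coprime a q) s a.
  rewrite /ramanujan_sum.
  elim/big_rec2: _ => // a _ y _ <-.
  by case: y => u v.
case: q @s => [|[|q]] s; first by rewrite big_geq.
  rewrite big_mkcond big_nat1 /= /s.
  have -> : 2 * pi * 1 * n%:~R / 1 = 2 * pi * n%:~R - 0 :> R.
    by rewrite divr1 mulr1 subr0.
  by rewrite sinB2pi_int sin0 oppr0.
set Q := q.+2 in s *.
have Q0 : Q%:R != 0 :> R by rewrite pnatr_eq0.
have anti a : (1 <= a < Q)%N -> s (Q - a)%N = - s a.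
  move=> /andP[_ aQ]; rewrite /s natrB ?(ltnW aQ)//.
  rewrite mulrBr mulrBl mulrBl (mulrAC (2 * pi) Q%:R) mulfK//.
  exact: sinB2pi_int.
rewrite big_mkcond big_nat_recr//= /coprime gcdnn /= addr0.
set S := \sum_(1 <= a < Q) _.
suff : S = - S.
  by move/eqP; rewrite -subr_eq0 opprK -mulr2n mulrn_eq0 /= => /eqP.
rewrite {1}/S big_nat_rev /= /S -sumrN big_nat_cond [RHS]big_nat_cond.
apply: eq_bigr => a /andP[aQ _]; have /andP[a1 aq] := aQ.
rewrite add1n subSS anti//.
have -> : gcdn (Q - a) Q = gcdn a Q.
  have /subnK aK := ltnW aq.
  by rewrite -[in LHS]aK addnK gcdnDl -[in RHS]aK gcdnDr gcdnC.
by case: ifP; rewrite ?oppr0.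
Qed.

(* For fixed k both series below converge absolutely, because
   |c_q(-k)| <= sigma(k) and phi(q) >> q^(1 - epsilon).  The first one is taken
   over the reals through Re, which loses nothing by ramanujan_sum_real. *)
Definition singular_tail (R : realType) (y : R) (k : nat) : R :=
  limn (fun n : nat => \sum_(1 <= q < n | y < q%:R)
     ((moebius q)%:~R ^+ 2 / (totient q)%:R ^+ 2
      * complex.Re (ramanujan_sum R q (- k%:Z)))).

Definition totient_tail (R : realType) (y : R) : R :=
  limn (fun n : nat => \sum_(1 <= q < n | y < q%:R)
     ((moebius q)%:~R ^+ 2 / (totient q)%:R ^+ 3 : R)).

(* Main.v *)
(* Write w(q) = mu(q)^2 / phi(q)^2, m = floor y and n = floor N.  Inserting
   c_q(k) = sum_{d | q, d | k} d mu(q/d) and counting the k <= n divisible by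
   [d,e] gives
     sum_{k <= n} S_y(k)^2
       = sum_{q,r > m} w(q) w(r) sum_{d | q, e | r} d mu(q/d) e mu(r/e) floor(n/[d,e]).
   Replacing the floor by n/[d,e] produces exactly n sum_{q > m} mu(q)^2/phi(q)^3,
   because the c_q are orthogonal in mean.  The floor costs at most sqrt(n/[d,e])
   (Rankin's trick), and (d,e)^(1/2) <= sum_{f | d, f | e} f^(1/2) bounds the
   total cost by
     sqrt n * sum_f sqrt f (sum_{q > m, f | q} w(q) sum_{f | d | q} sqrt d)^2,
   which is O(sqrt n / m); avoiding logarithms here requires averaging the
   powers of q/phi(q) instead of bounding them pointwise.  As the tail of
   mu^2/phi^3 is of exact order 1/m^2, the relative error is O((y^2/N)^(1/2)),
   stronger than what is asked.  The estimates are uniform in a truncation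
   q <= M, so no infinite sums need be interchanged. *)
Require Import Defs.
From mathcomp Require Import all_boot all_order all_algebra cyclic.
From mathcomp Require Import zify ring lra.
From mathcomp Require Import all_classical all_reals all_analysis.
Import Order.TTheory GRing.Theory Num.Theory.
Import numFieldNormedType.Exports.
Local Open Scope ring_scope.

(** * The Moebius function *)

(** Most divisor sums are kept over one index type ['I_M.+1], with [M] a common bound, so that they
    can be exchanged freely. The substitution [q = f a] therefore has to carry the bound
    [f * a <= M]. *)
Lemma sum_multiples (V : nmodType) (M f : nat) (P : pred nat) (F : nat -> V) :
  (0 < f)%N ->
  \sum_(q < M.+1 | (f %| q)%N && P q) F q =
  \sum_(a < M.+1 | (f * a <= M)%N && P (f * a)%N) F (f * a)%N.
Proof.
move=> f0; pose h (a : 'I_M.+1) : 'I_M.+1 := inord (f * a).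
pose h' (q : 'I_M.+1) : 'I_M.+1 := inord (q %/ f).
have h'K (q : 'I_M.+1) : nat_of_ord (h' q) = (q %/ f)%N.
  by rewrite inordK// ltnS (leq_trans (leq_div _ _))// -ltnS.
rewrite (reindex_onto h h') => [|i /andP[fi _]]; last first.
  by apply: val_inj; rewrite /h h'K mulnC divnK// inord_val.
have hK (a : 'I_M.+1) : (f * a <= M)%N -> nat_of_ord (h a) = (f * a)%N.
  by move=> le; rewrite inordK.
apply: eq_big => [a|a].
  have [le|lt] := leqP (f * a) M.
    rewrite hK// dvdn_mulr//=.
    have -> : h' (h a) = a by apply: val_inj; rewrite /= h'K hK// mulKn.
    by rewrite eqxx andbT.
  apply/negbTE/negP => /andP[/andP[fh _] /eqP/(congr1 val)/=].
  rewrite h'K => e; move: lt; rewrite -e mulnC divnK// ltnNge.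
  by rewrite -ltnS ltn_ord.
move=> /andP[/andP[fh _] /eqP/(congr1 val)/=]; rewrite h'K => e.
by congr F; rewrite -e mulnC divnK.
Qed.

Lemma sum_codivisors (V : nmodType) (M n : nat) (P : pred nat) (F : nat -> V) :
  (0 < n <= M)%N ->
  \sum_(d < M.+1 | (d %| n)%N && P d) F d =
  \sum_(d < M.+1 | (d %| n)%N && P (n %/ d)%N) F (n %/ d)%N.
Proof.
move=> /andP[n0 nM]; pose h (d : 'I_M.+1) : 'I_M.+1 := inord (n %/ d).
have hK (d : 'I_M.+1) : nat_of_ord (h d) = (n %/ d)%N.
  by rewrite inordK// ltnS (leq_trans (leq_div _ _)).
have divK (d : 'I_M.+1) : (d %| n)%N -> h (h d) = d.
  by move=> dn; apply: val_inj; rewrite /= !hK divnA// mulKn.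
rewrite (reindex_onto h h) => [|d /andP[dn _]]; last exact: divK.
apply: eq_big => [d|d _]; last by rewrite hK.
rewrite hK; apply/andP/andP => -[].
  move=> /andP[dn Pd] /eqP/(congr1 val)/=; rewrite !hK => e; split=> //.
  by rewrite -e dvdn_div.
by move=> dn Pd; rewrite dvdn_div// Pd divK.
Qed.

Lemma squarefreeP (n : nat) :
  reflect ((0 < n)%N /\ forall p, prime p -> ~~ (p ^ 2 %| n)%N) (squarefree n).
Proof.
apply: (iffP andP) => -[n0 h]; split=> //.
  move=> p pp; apply/negP => p2n; move/allP: h => /(_ p).
  rewrite mem_primes pp n0 p2n /= => /(_ _)/negP; apply.
    by rewrite (dvdn_trans _ p2n)// dvdn_exp.
  by [].
by apply/allP => p; rewrite mem_primes => /andP[/h].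
Qed.

Lemma squarefree_dvd (m n : nat) : (m %| n)%N -> squarefree n -> squarefree m.
Proof.
move=> mn /squarefreeP[n0 h]; apply/squarefreeP.
split=> [|p /h]; first exact: dvdn_gt0 mn.
by apply: contra => pm; apply: dvdn_trans mn.
Qed.

Lemma squarefree_coprime (m n : nat) : squarefree (m * n) -> coprime m n.
Proof.
move=> /squarefreeP[]; rewrite muln_gt0 => /andP[m0 n0] h.
rewrite coprime_has_primes//; apply/hasPn => p.
rewrite !mem_primes n0 m0 /= => /andP[pp pn]; apply/negP; rewrite pp /= => pm.
by move/negP: (h p pp); apply; rewrite dvdn_mul.
Qed.

Lemma squarefree_primeM (p n : nat) : prime p -> ~~ (p %| n)%N ->
  squarefree (p * n) = squarefree n.
Proof.
move=> pp pn; have n0 : (0 < n)%N by case: n pn => //; rewrite dvdn0.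
apply/idP/idP; first by apply: squarefree_dvd; rewrite dvdn_mull.
move=> /squarefreeP[_ h]; apply/squarefreeP; split.
  by rewrite muln_gt0 prime_gt0.
move=> r pr; have [->|rp] := eqVneq r p.
  by rewrite -mulnn dvdn_pmul2l// prime_gt0.
rewrite Gauss_dvdr; first exact: h.
by rewrite coprime_pexpl// prime_coprime// dvdn_prime2.
Qed.

Lemma moebius_primeM (p n : nat) : prime p -> (0 < n)%N ->
  moebius (p * n) = if (p %| n)%N then 0 else - moebius n.
Proof.
move=> pp n0; rewrite /moebius; have [pn|pn] := boolP (p %| n)%N.
  case: ifPn => // /squarefreeP[_ h]; move: (h p pp).
  by rewrite -mulnn dvdn_pmul2l ?prime_gt0// pn.
rewrite squarefree_primeM//; case: ifP => _; last by rewrite oppr0.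
rewrite (@perm_size _ _ (p :: primes n)) /= ?exprS ?mulN1r//.
apply: uniq_perm; rewrite /= ?primes_uniq ?mem_primes ?(negPf pn) ?andbF//.
by move=> r; rewrite primesM ?n0 ?prime_gt0// primes_prime// !inE.
Qed.

(** For a prime factor [p] of [n > 1], the divisors [d] prime to [p] cancel against the divisors
    [p * d], because [moebius (p * d) = - moebius d]; divisors divisible by [p ^ 2] contribute 0. *)
Lemma sum_moebius (M n : nat) : (0 < n <= M)%N ->
  \sum_(d < M.+1 | (d %| n)%N) moebius d = (n == 1%N)%:R.
Proof.
move=> /andP[n0 nM]; have [->|n1] := eqVneq n 1%N.
  have M1 : (1 < M.+1)%N by rewrite ltnS (leq_trans _ nM).
  rewrite (bigD1 (Ordinal M1))//= big1 => [|d /andP[]]; first by rewrite addr0.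
  by rewrite dvdn1 => /eqP d1 /eqP[]; apply: val_inj.
have pp : prime (pdiv n) by rewrite pdiv_prime// ltn_neqAle eq_sym n1.
set p := pdiv n in pp; have pn : (p %| n)%N := pdiv_dvd n.
have p0 := prime_gt0 pp.
rewrite (bigID (fun d : 'I__ => (p %| d)%N)) /=.
under eq_bigl do rewrite andbC.
rewrite (sum_multiples _ M p (fun d => (d %| n)%N) moebius)//.
rewrite [X in X + _](bigID (fun d : 'I__ => (p %| d)%N)) /= big1 => [|d]; last first.
  case/andP=> /andP[_ pdn] pd; rewrite moebius_primeM// ?pd//.
  by have := dvdn_gt0 n0 pdn; rewrite muln_gt0 => /andP[].
rewrite add0r (eq_big (fun d : 'I_M.+1 => (d %| n)%N && ~~ (p %| d)%N)
  (fun d : 'I_M.+1 => - moebius d)).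
- by rewrite sumrN addNr.
- move=> d; case pd: (p %| d)%N; first by rewrite !andbF.
  rewrite !andbT Gauss_dvd ?prime_coprime ?pd// pn /=.
  case dn: (d %| n)%N; rewrite ?andbF ?andbT//.
  apply: leq_trans nM; apply: dvdn_leq => //.
  by rewrite Gauss_dvd ?prime_coprime ?pd// pn.
- move=> d /andP[/andP[_ pdn] /negPf pd]; rewrite moebius_primeM ?pd//.
  by have := dvdn_gt0 n0 pdn; rewrite muln_gt0 => /andP[].
Qed.

(** Moebius inversion: under [d -> n / d] the condition [f | d | n] becomes [d | n / f], so the sum
    detects [n / f = 1]. *)
Lemma sum_moebius_interval (M f n : nat) : (0 < f)%N -> (0 < n <= M)%N ->
  \sum_(d < M.+1 | (d %| n)%N && (f %| d)%N) moebius (n %/ d) = (f == n)%:R.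
Proof.
move=> f0 /andP[n0 nM].
rewrite (sum_codivisors _ M n (dvdn f) (fun d => moebius (n %/ d)))  ?n0//.
have [fn|fn] := boolP (f %| n)%N; last first.
  rewrite big1 => [|d /andP[dn fd]].
    by case: eqVneq fn => // ->; rewrite dvdnn.
  by case/negP: fn; apply: dvdn_trans fd _; apply: dvdn_div.
have nf0 : (0 < n %/ f)%N by rewrite divn_gt0// dvdn_leq.
rewrite (eq_big (fun d : 'I_M.+1 => (d %| n %/ f)%N) (fun d : 'I_M.+1 => moebius d)).
- rewrite sum_moebius ?nf0 ?(leq_trans (leq_div _ _))//.
  congr _%:R; rewrite -(eqn_pmul2l f0) muln1 mulnC divnK//.
  by rewrite eq_sym.
- move=> d; case dn: (d %| n)%N => /=.
    have d0 := dvdn_gt0 n0 dn.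
    by rewrite -(dvdn_pmul2r d0) divnK// -[RHS](dvdn_pmul2r f0) divnK// mulnC.
  apply/esym/negP => h; move/negP: dn; apply.
  by apply: dvdn_trans h _; apply: dvdn_div.
- by move=> d /andP[dn _]; rewrite divnA// mulKn.
Qed.

(** * Ramanujan sums as divisor sums *)

Lemma big_nat1_ord (V : nmodType) (n : nat) (P : pred nat) (F : nat -> V) :
  \sum_(1 <= a < n.+1 | P a) F a = \sum_(a < n.+1 | (0 < a)%N && P a) F a.
Proof.
rewrite -(big_mkord (fun a => (0 < a)%N && P a)) [RHS]big_mkcond/= big_nat_recl//=.
rewrite add0r [LHS]big_mkcond/= big_add1 /=.
exact: eq_bigr.
Qed.

Lemma cosD2pi_nat (R : realType) (t : R) (n : nat) :
  cos (t + 2 * pi * n%:R) = cos t.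
Proof.
elim: n => [|n IH]; first by rewrite mulr0 addr0.
have -> : t + 2 * pi * n.+1%:R = t + 2 * pi * n%:R + pi *+ 2.
  by rewrite -natr1; ring.
by rewrite cosD2pi.
Qed.

Lemma sinD2pi_nat (R : realType) (t : R) (n : nat) :
  sin (t + 2 * pi * n%:R) = sin t.
Proof.
elim: n => [|n IH]; first by rewrite mulr0 addr0.
have -> : t + 2 * pi * n.+1%:R = t + 2 * pi * n%:R + pi *+ 2.
  by rewrite -natr1; ring.
by rewrite sinD2pi.
Qed.

Lemma sum_cos_frac (R : realType) (q k : nat) : (0 < q)%N ->
  \sum_(1 <= b < q.+1) cos (2 * pi * b%:R * k%:R / q%:R : R) =
  if (q %| k)%N then q%:R else 0.
Proof.
move=> q0; have q0R : q%:R != 0 :> R by rewrite pnatr_eq0 -lt0n.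
(* Reducing [k] modulo [q] places [t / 2] strictly between 0 and pi when [q] does not divide [k], so
   that [sin (t / 2)] can be cancelled. *)
pose t : R := 2 * pi * (k %% q)%N%:R / q%:R.
(* 2 sin(t/2) cos(b t) = sin((b + 1/2) t) - sin((b - 1/2) t) telescopes below. *)
rewrite (eq_bigr (fun b : nat => cos (b%:R * t))) => [|b _]; last first.
  rewrite -(cosD2pi_nat _ (b%:R * t) (b * (k %/ q))); congr cos.
  rewrite /t {1}(divn_eq k q) natrD !natrM; field.
  exact: q0R.
rewrite /dvdn; case: eqP => [r0|/eqP r0].
  rewrite (eq_bigr (fun=> 1)) => [|b _].
    by rewrite sumr_const_nat subn1.
  by rewrite /t r0 mulr0 mul0r mulr0 cos0.
have rq : ((k %% q)%N%:R < q%:R :> R) by rewrite ltr_nat ltn_mod.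
have rp : (0 < (k %% q)%N%:R :> R) by rewrite ltr0n lt0n.
have q0p : (0 < q%:R :> R) by rewrite ltr0n.
have s0 : 0 < sin (t / 2).
  have -> : t / 2 = pi * ((k %% q)%N%:R / q%:R) by rewrite /t; field.
  apply: sin_gt0_pi; apply/andP; split.
    by rewrite mulr_gt0 ?pi_gt0 ?divr_gt0.
  by rewrite gtr_pMr ?pi_gt0// ltr_pdivrMr// mul1r.
apply: (mulfI (lt0r_neq0 s0)); rewrite mulr0 mulr_sumr.
pose G b : R := sin (b%:R * t - t / 2) / 2.
rewrite (eq_bigr (fun b => G b.+1 - G b)) => [|b _].
  rewrite telescope_sumr// /G.
  (* The two ends of the telescope differ by [k %% q] full turns. *)
  have -> : q.+1%:R * t - t / 2 = 1 * t - t / 2 + 2 * pi * (k %% q)%N%:R.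
    rewrite /t -natr1; field.
    exact: q0R.
  by rewrite sinD2pi_nat subrr.
rewrite /G -mulrBl.
have -> : b.+1%:R * t - t / 2 = b%:R * t + t / 2 by rewrite -natr1; field.
by rewrite sinB sinD; field.
Qed.

Lemma Re_ramanujan_sum (R : realType) (q k : nat) :
  complex.Re (ramanujan_sum R q (- k%:Z)) =
  \sum_(1 <= a < q.+1 | coprime a q) cos (2 * pi * a%:R * k%:R / q%:R).
Proof.
rewrite /ramanujan_sum.
elim/big_rec2: _ => // a _ y _ <-; case: y => u v /=.
by rewrite mulrNz mulrN mulNr cosN.
Qed.

(** Coprimality of [a] and [q] is detected by the sum of [moebius d] over the common divisors [d].
    For fixed [d], the multiples [a] of [d] give a complete cosine sum modulo [q / d], evaluated by
    [sum_cos_frac]; renaming [q / d] as [d] gives the formula. *)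
Lemma ramanujan_sum_divisors (R : realType) (M q k : nat) : (0 < q <= M)%N ->
  complex.Re (ramanujan_sum R q (- k%:Z)) =
  \sum_(d < M.+1 | (d %| q)%N && (d %| k)%N) d%:R * (moebius (q %/ d))%:~R.
Proof.
move=> /andP[q0 qM]; rewrite Re_ramanujan_sum.
pose C a : R := cos (2 * pi * a%:R * k%:R / q%:R).
rewrite big_mkcond /= (eq_big_nat _ _
  (F2 := fun a => \sum_(d < M.+1 | (d %| q)%N)
    (if (d %| a)%N then (moebius d)%:~R * C a else 0))); last first.
  move=> a /andP[a0 aq]; rewrite -big_mkcondr /= -mulr_suml -rmorph_sum /=.
  under eq_bigl do rewrite andbC -dvdn_gcd.
  have gM : (0 < gcdn a q <= M)%N.
    rewrite gcdn_gt0 a0 /=; apply: leq_trans qM.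
    by rewrite dvdn_leq// dvdn_gcdr.
  rewrite (sum_moebius M _ gM) /coprime.
  by case: eqP => _; rewrite ?mul1r ?mul0r.
rewrite exchange_big /=.
rewrite (sum_codivisors _ M q (fun d => (d %| k)%N)
  (fun d => d%:R * (moebius (q %/ d))%:~R)) ?q0//.
rewrite big_mkcondr /=; apply: eq_bigr => d dq.
have d0 := dvdn_gt0 q0 dq.
rewrite -big_mkcond /= -mulr_sumr divnA// mulKn// mulrC.
have qd0 : (0 < q %/ d)%N by rewrite divn_gt0// dvdn_leq.
rewrite -[LHS]/(_ * _) (_ : \sum_(1 <= _ < _ | _) _ =
   if (q %/ d %| k)%N then (q %/ d)%:R else 0).
  by case: ifP; rewrite ?mul0r.
rewrite -sum_cos_frac// !big_nat1_ord.
under eq_bigl do rewrite andbC.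
rewrite (sum_multiples _ q d (fun a => (0 < a)%N) C)//.
under [RHS]eq_bigl do rewrite andbT.
rewrite (big_ord_widen_cond q.+1 (fun b => (0 < b)%N)
  (fun b => cos (2 * pi * b%:R * k%:R / (q %/ d)%:R))) ?ltnS ?leq_div//.
apply: eq_big => [b|b _].
  by rewrite muln_gt0 d0 andbC ltnS leq_divRL// mulnC.
have qE : q%:R = (q %/ d)%:R * d%:R :> R by rewrite -natrM divnK.
rewrite /C; congr cos; rewrite qE natrM; field.
by rewrite !pnatr_eq0 -!lt0n qd0.
Qed.

(** * Tails of convergent sums *)

Lemma sum_tail_telescope (R : realDomainType) (F G : nat -> R) (m B : nat) :
  (forall b, (0 < b)%N -> F b <= G b - G b.+1) -> (forall b, 0 <= G b) ->
  \sum_(b < B | (m < b)%N) F b <= G m.+1.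
Proof.
move=> FG G0.
(* The [maxn] keeps the telescoped bound valid while the range is still empty, which makes the
   induction on [B] go through. *)
suff : \sum_(b < B | (m < b)%N) F b <= G m.+1 - G (maxn m.+1 B).
  by move=> /le_trans; apply; rewrite gerBl.
rewrite -(big_mkord (fun b => m < b)%N F).
elim: B => [|B IH]; first by rewrite big_geq// maxn0 subrr.
rewrite big_mkcond big_nat_recr//= -big_mkcond /=.
case: ifPn => [mB|]; last rewrite -leqNgt => Bm.
  move: IH; rewrite (maxn_idPr mB) (maxn_idPr (leqW mB)) => IH.
  have := FG B (leq_ltn_trans (leq0n _) mB); lra.
rewrite addr0; apply: (le_trans IH).
have Bm' : (B.+1 <= m.+1)%N by [].
by rewrite (maxn_idPl (leqW Bm)) (maxn_idPl Bm').
Qed.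

Lemma sum_tail_pow32 (R : realType) (z : R) (B : nat) : 0 < z ->
  \sum_(b < B | z < b%:R) (b%:R * Num.sqrt b%:R)^-1 <= 4 / Num.sqrt z.
Proof.
move=> z0; pose m := Num.truncn z.
rewrite (eq_bigl (fun b : 'I_B => (m < b)%N)) => [|b]; last first.
  by rewrite truncn_lt_nat// ltW.
apply: (@le_trans _ _ (4 / Num.sqrt m.+1%:R)); last first.
  rewrite ler_pM2l// lef_pV2 ?posrE ?sqrtr_gt0// ler_wsqrtr//.
  by rewrite ltW// truncnS_gt.
apply: (sum_tail_telescope _ (fun b => (b%:R * Num.sqrt b%:R)^-1)
  (fun b => 4 / Num.sqrt b%:R)) => b.
- move=> b0; have bp : 0 < b%:R :> R by rewrite ltr0n.
  set x := Num.sqrt b%:R; set y := Num.sqrt b.+1%:R.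
  have x0 : 0 < x by rewrite sqrtr_gt0.
  have y0 : 0 < y by rewrite sqrtr_gt0.
  have xE : x ^+ 2 = b%:R by rewrite sqr_sqrtr// ltW.
  have yE : y ^+ 2 = x ^+ 2 + 1 by rewrite sqr_sqrtr// xE natr1.
  have b1 : 1 <= x ^+ 2 by rewrite xE ler1n.
  have xy : x <= y by rewrite ler_wsqrtr// ler_nat.
  (* Crude, since [y ^+ 2 = x ^+ 2 + 1 <= 2 * x ^+ 2]. It bounds [x * y * (x + y)] by 15/4 times the
     cube of [x], whence the constant 4. *)
  have y2 : y <= 3 / 2 * x.
    rewrite -(@ler_pXn2r _ 2) ?nnegrE ?mulr_ge0 ?ltW// exprMn yE.
    have -> : (3 / 2) ^+ 2 = 9 / 4 :> R by field.
    by lra.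
  rewrite -xE -mulrBr.
  have -> : x^-1 - y^-1 = (x * y * (x + y))^-1.
    have d1 : (y - x) * (y + x) = 1 by rewrite -subr_sqr yE; ring.
    have xy0 : x + y != 0 by rewrite lt0r_neq0// addr_gt0.
    apply: (mulIf xy0); rewrite -[RHS](mulr1) -d1.
    by field; rewrite xy0 !lt0r_neq0.
  rewrite -[leLHS]mul1r ler_pdivrMr ?mulr_gt0 ?exprn_gt0//.
  rewrite mulrAC ler_pdivlMr ?mulr_gt0 ?addr_gt0// mul1r.
  apply: (@le_trans _ _ (x * (3 / 2 * x) * (x + 3 / 2 * x))).
    by apply: ler_pM; rewrite ?mulr_ge0 ?addr_ge0 ?(ltW x0) ?(ltW y0) ?ler_pM2l ?lerD2l.
  have -> : x * (3 / 2 * x) * (x + 3 / 2 * x) = 15 / 4 * (x ^+ 2 * x) by field.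
  have -> : 4 * (x ^+ 2 * x) = 15 / 4 * (x ^+ 2 * x) + (x ^+ 2 * x) / 4 by field.
  by rewrite lerDl divr_ge0 ?mulr_ge0 ?exprn_ge0 ?(ltW x0).
- by rewrite divr_ge0// sqrtr_ge0.
Qed.

Definition root4 (R : realType) (x : R) : R := Num.sqrt (Num.sqrt x).

Lemma sum_pow54 (R : realType) (B : nat) :
  \sum_(b < B | (0 < b)%N) (b%:R * root4 R b%:R)^-1 <= 30.
Proof.
apply: (@le_trans _ _ (30 / root4 R 1%:R)); last first.
  by rewrite /root4 !sqrtr1 divr1.
apply: (sum_tail_telescope _ (fun b => (b%:R * root4 R b%:R)^-1)
  (fun b => 30 / root4 R b%:R)) => b; last by rewrite divr_ge0// sqrtr_ge0.
move=> b0; have bp : 0 < b%:R :> R by rewrite ltr0n.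
set x := root4 R b%:R; set y := root4 R b.+1%:R.
have x0 : 0 < x by rewrite !sqrtr_gt0.
have y0 : 0 < y by rewrite !sqrtr_gt0.
have xE : x ^+ 4 = b%:R by rewrite (exprM x 2 2) !sqr_sqrtr// ?sqrtr_ge0// ltW.
have yE : y ^+ 4 = x ^+ 4 + 1.
  by rewrite (exprM y 2 2) !sqr_sqrtr// ?sqrtr_ge0// xE natr1.
have b1 : 1 <= x ^+ 4 by rewrite xE ler1n.
(* With this bound, [x y (x + y) (x^2 + y^2)] is at most [x * 2x * 3x * 5x^2 = 30 x^5], whence the
   constant 30. *)
have y2 : y <= 2 * x.
  rewrite -(@ler_pXn2r _ 4) ?nnegrE ?mulr_ge0 ?ltW// exprMn yE.
  have -> : 2 ^+ 4 = 16 :> R by ring.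
  by lra.
rewrite -xE -mulrBr.
have s0 : 0 < (x + y) * (x ^+ 2 + y ^+ 2) by rewrite mulr_gt0 ?addr_gt0 ?exprn_gt0.
have -> : x^-1 - y^-1 = (x * y * ((x + y) * (x ^+ 2 + y ^+ 2)))^-1.
  have d1 : (y - x) * ((x + y) * (x ^+ 2 + y ^+ 2)) = 1.
    have -> : 1 = y ^+ 4 - x ^+ 4 :> R by rewrite yE; ring.
    by ring.
  apply: (mulIf (lt0r_neq0 s0)); rewrite -[RHS](mulr1) -d1.
  by field; rewrite !lt0r_neq0// ?addr_gt0 ?exprn_gt0.
rewrite -[leLHS]mul1r ler_pdivrMr ?mulr_gt0 ?exprn_gt0//.
rewrite mulrAC ler_pdivlMr ?(mulr_gt0 _ s0) ?(mulr_gt0 x0)// mul1r.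
apply: (@le_trans _ _ (x * (2 * x) * ((x + 2 * x) * (x ^+ 2 + (2 * x) ^+ 2)))).
  apply: ler_pM; rewrite ?(ltW s0) ?mulr_ge0 ?(ltW x0) ?(ltW y0) ?ler_pM2l//.
  apply: ler_pM; rewrite ?addr_ge0 ?exprn_ge0 ?lerD2l ?(ltW x0) ?(ltW y0)//.
  by rewrite ler_pXn2r ?nnegrE ?mulr_ge0 ?(ltW x0) ?(ltW y0).
have -> : x * (2 * x) * ((x + 2 * x) * (x ^+ 2 + (2 * x) ^+ 2)) = 30 * (x ^+ 4 * x) by ring.
by [].
Qed.

(** The divisor function sigma_{-1/4}. It serves as a majorant for powers of [n / phi(n)] that is
    bounded on average. *)
Definition divsum_root4 (R : realType) (n : nat) : R :=
  \sum_(d <- divisors n) (root4 R d%:R)^-1.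

Lemma sum_divisors_ord (V : nmodType) (M n : nat) (F : nat -> V) :
  (0 < n <= M)%N ->
  \sum_(d <- divisors n) F d = \sum_(d < M.+1 | (d %| n)%N) F d.
Proof.
move=> /andP[n0 nM].
rewrite -(big_mkord (fun d => (d %| n)%N)) -big_filter.
apply: perm_big; apply: uniq_perm.
- exact: divisors_uniq.
- exact/filter_uniq/iota_uniq.
- move=> d; rewrite mem_filter mem_index_iota -dvdn_divisors//.
  case dn: (d %| n)%N => //=.
  by rewrite ltnS (leq_trans _ nM)// dvdn_leq.
Qed.

(** Opening the divisor sum and writing [a = d b], the sum over [b > z / d] is at most
    [4 sqrt (d / z)] by [sum_tail_pow32]. The powers of [d] combine to [d^(-5/4)], which is summable
    by [sum_pow54], and [120 = 4 * 30]. *)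
Lemma sum_tail_divsum (R : realType) (z : R) (M : nat) : 0 < z ->
  \sum_(a < M.+1 | z < a%:R) divsum_root4 R a / (a%:R * Num.sqrt a%:R) <=
  120 / Num.sqrt z.
Proof.
move=> z0; have pos (a : nat) : z < a%:R -> (0 < a)%N.
  by move=> za; rewrite -(ltr_nat R); apply: lt_trans za.
rewrite (eq_bigr (fun a : 'I_M.+1 => \sum_(d < M.+1 | (d %| a)%N)
    (root4 R d%:R)^-1 / (a%:R * Num.sqrt a%:R))) => [|a za]; last first.
  rewrite -mulr_suml -(sum_divisors_ord _ M a (fun d => (root4 R d%:R)^-1))//.
  by rewrite pos// -ltnS ltn_ord.
rewrite (exchange_big_dep (fun d : 'I_M.+1 => (0 < d)%N)) /=; last first.
  by move=> a d za da; apply: dvdn_gt0 da; apply: pos.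
apply: (@le_trans _ _ (\sum_(d < M.+1 | (0 < d)%N)
    4 / Num.sqrt z * (d%:R * root4 R d%:R)^-1)); last first.
  rewrite -mulr_sumr; have := sum_pow54 R M.+1.
  rewrite -(ler_pM2l (_ : 0 < 4 / Num.sqrt z)) ?divr_gt0 ?sqrtr_gt0//.
  by move=> /le_trans; apply; rewrite mulrAC -natrM.
apply: ler_sum => d d0; have dp : 0 < d%:R :> R by rewrite ltr0n.
under eq_bigl do rewrite andbC.
rewrite (sum_multiples _ M d (fun a => z < a%:R)
  (fun a => (root4 R d%:R)^-1 / (a%:R * Num.sqrt a%:R)))//.
pose T b : R := (b%:R * Num.sqrt b%:R)^-1.
apply: (@le_trans _ _ (\sum_(b < M.+1 | z / d%:R < b%:R)
   (root4 R d%:R)^-1 * (d%:R * Num.sqrt d%:R)^-1 * T b)).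
  rewrite big_mkcond [leRHS]big_mkcond; apply: ler_sum => b _ /=.
  rewrite ltr_pdivrMr// -natrM mulnC.
  case: (z < _); last by rewrite andbF.
  rewrite andbT; have h : (root4 R d%:R)^-1 / ((b * d)%:R * Num.sqrt (b * d)%:R)
    = (root4 R d%:R)^-1 * (d%:R * Num.sqrt d%:R)^-1 * T b.
    by rewrite natrM sqrtrM// /T -[RHS]mulrA; congr (_ * _); rewrite -invfM; congr GRing.inv; ring.
  case: ifP => _; first by rewrite h.
  by rewrite -h mulr_ge0// invr_ge0 ?mulr_ge0 ?sqrtr_ge0.
rewrite -mulr_sumr.
have zd : 0 < z / d%:R by rewrite divr_gt0.
have := sum_tail_pow32 R _ M.+1 zd.
rewrite -(ler_pM2l (_ : 0 < (root4 R d%:R)^-1 * (d%:R * Num.sqrt d%:R)^-1)).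
  move=> /le_trans; apply; rewrite sqrtrM ?(ltW z0)// sqrtrV ?(ltW dp)//.
  rewrite le_eqVlt; apply/orP; left; apply/eqP.
  by field; rewrite !lt0r_neq0 ?sqrtr_gt0.
by rewrite mulr_gt0 ?invr_gt0 ?mulr_gt0 ?sqrtr_gt0.
Qed.

(** * Powers of n / phi(n) on average *)

(** The divisor function sigma_{-1/2}: the sum of [sqrt d] over the divisors [d] of [n] is [sqrt n]
    times it. *)
Definition divsum_root2 (R : realType) (n : nat) : R :=
  \sum_(d <- divisors n) (Num.sqrt d%:R)^-1.

(** Peels off the least prime factor, which reduces inequalities between multiplicative functions to
    their Euler factors. *)
Lemma squarefree_ind (P : nat -> Prop) : P 1%N ->
  (forall p n, prime p -> ~~ (p %| n)%N -> squarefree n -> P n -> P (p * n)%N) ->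
  forall n, squarefree n -> P n.
Proof.
move=> P1 PM n; have [k] := ubnP n; elim: k n => // k IH n nk sn.
have [->//|n1] := eqVneq n 1%N.
have n0 : (0 < n)%N by case/squarefreeP: sn.
have pp : prime (pdiv n) by rewrite pdiv_prime// ltn_neqAle eq_sym n1.
have nE : n = (pdiv n * (n %/ pdiv n))%N by rewrite mulnC divnK// pdiv_dvd.
have sm : squarefree (n %/ pdiv n) by apply: squarefree_dvd sn; rewrite dvdn_div// pdiv_dvd.
rewrite nE; apply: PM => //.
  by rewrite -prime_coprime//; apply: squarefree_coprime; rewrite -nE.
apply: IH => //; rewrite -ltnS (leq_trans _ nk)// ltnS.
by rewrite ltn_Pdiv// prime_gt1.
Qed.

Lemma sum_divisors_primeM (R : pzRingType) (F : nat -> R) (p n : nat) :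
  prime p -> ~~ (p %| n)%N -> (0 < n)%N ->
  (forall d, F (p * d)%N = F p * F d) ->
  \sum_(d <- divisors (p * n)) F d = (1 + F p) * \sum_(d <- divisors n) F d.
Proof.
move=> pp pn n0 FM; have p0 := prime_gt0 pp.
rewrite (perm_big (divisors n ++ map (muln p) (divisors n))).
  rewrite big_cat big_map /= mulrDl mul1r mulr_sumr; congr (_ + _).
  by apply: eq_bigr => d _; rewrite FM.
apply: uniq_perm.
- exact: divisors_uniq.
- rewrite cat_uniq divisors_uniq map_inj_uniq ?divisors_uniq ?andbT; last first.
    by move=> x y /eqP; rewrite eqn_pmul2l// => /eqP.
  apply/hasPn => _ /mapP[d _ ->]; rewrite -dvdn_divisors//.
  by apply: contra pn; apply: dvdn_trans; rewrite dvdn_mulr.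
- move=> d; rewrite mem_cat -!dvdn_divisors ?muln_gt0 ?p0//.
  apply/idP/orP => [dpn|[dn|/mapP[e]]].
  + have [pd|pd] := boolP (p %| d)%N; last first.
      by left; rewrite -(@Gauss_dvdr _ p)// coprime_sym prime_coprime.
    right; apply/mapP; exists (d %/ p)%N; last by rewrite mulnC divnK.
    by rewrite -dvdn_divisors// -(dvdn_pmul2l p0) mulnC divnK.
  + exact: dvdn_mull.
  + by rewrite -dvdn_divisors// => en ->; rewrite dvdn_pmul2l.
Qed.

(** With [x = p^(-1/4)] one has [p / (p - 1) = 1 / (1 - x^4)], so for large [p] the claim is
    [1 + x^2 <= (1 + x) (1 - x^4)^4], where the linear term in [x] wins. For [p <= 80] the left side
    is at most [2 * 2^4 = 32]. *)
Lemma euler_factor_bound (R : realType) (p : nat) : prime p ->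
  (1 + (Num.sqrt p%:R)^-1) * (p%:R / p.-1%:R) ^+ 4 <=
  32 ^+ (p <= 80)%N * (1 + (root4 R p%:R)^-1).
Proof.
move=> pp; have p1 := prime_gt1 pp; have p0 := prime_gt0 pp.
have pR : 0 < p%:R :> R by rewrite ltr0n.
have pE : p.-1%:R = p%:R - 1 :> R by rewrite -subn1 natrB.
have p2 : 2 <= p%:R :> R by rewrite ler_nat.
set x := (root4 R p%:R)^-1; have x0 : 0 < x by rewrite invr_gt0 !sqrtr_gt0.
have x2 : (Num.sqrt p%:R)^-1 = x ^+ 2 :> R.
  by rewrite /x exprVn sqr_sqrtr// sqrtr_ge0.
have x4 : x ^+ 4 * p%:R = 1.
  by rewrite (exprM x 2 2) -x2 exprVn sqr_sqrtr ?mulVf ?gt_eqF ?ltW.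
clearbody x; rewrite x2 pE.
have r0 : 0 <= p%:R / (p%:R - 1) :> R by rewrite divr_ge0// subr_ge0 ler1n.
have [p80|p80] := leqP p 80; rewrite /= ?expr1 ?expr0 ?mul1r.
  apply: (@le_trans _ _ (2 * 16)).
    apply: ler_pM; rewrite ?addr_ge0 ?exprn_ge0 ?(ltW x0)//.
      have : x ^+ 2 <= 1; last by lra.
      rewrite -x2 invf_le1 ?sqrtr_gt0//.
      by rewrite -[leLHS]sqrtr1; apply: ler_wsqrtr; rewrite ler1n.
    have -> : 16 = 2 ^+ 4 :> R by ring.
    rewrite ler_pXn2r ?nnegrE//.
    by rewrite ler_pdivrMr; lra.
  have -> : 2 * 16 = 32 * 1 :> R by ring.
  by rewrite ler_pM2l// lerDl ltW.
have -> : p%:R / (p%:R - 1) = (1 - x ^+ 4)^-1.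
  have -> : 1 - x ^+ 4 = x ^+ 4 * (p%:R - 1) by rewrite mulrBr mulr1 x4.
  rewrite invfM; congr (_ / _).
  by apply: (mulfI (lt0r_neq0 (exprn_gt0 4 x0))); rewrite x4 divff// lt0r_neq0// exprn_gt0.
(* The threshold is chosen so that [p >= 81 = 3^4]. *)
have x3 : x <= 1 / 3.
  rewrite -(@ler_pXn2r _ 4) ?nnegrE ?divr_ge0 ?(ltW x0)//.
  have -> : x ^+ 4 = p%:R^-1.
    by apply: (mulIf (lt0r_neq0 pR)); rewrite x4 mulVf// lt0r_neq0.
  have -> : (1 / 3) ^+ 4 = 81%:R^-1 :> R by field.
  by rewrite lef_pV2 ?posrE// ler_nat.
have t3 : x ^+ 3 <= 1 / 27.
  have -> : 1 / 27 = (1 / 3) ^+ 3 :> R by field.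
  by rewrite ler_pXn2r ?nnegrE ?divr_ge0 ?(ltW x0).
have t4 : x ^+ 4 <= 1 / 81.
  have -> : 1 / 81 = (1 / 3) ^+ 4 :> R by field.
  by rewrite ler_pXn2r ?nnegrE ?divr_ge0 ?(ltW x0).
have t40 : 0 < x ^+ 4 by rewrite exprn_gt0.
rewrite exprVn ler_pdivrMr; last by rewrite exprn_gt0//; lra.
(* Bernoulli's inequality; the surplus that remains is [x (1 - x - 4 x^3 - 4 x^4)], nonnegative for
   [x <= 1/3]. *)
have b4 : 1 - 4 * x ^+ 4 <= (1 - x ^+ 4) ^+ 4.
  move: t4 t40; set t := x ^+ 4 => t4 t40.
  have -> : (1 - t) ^+ 4 = 1 - 4 * t + t ^+ 2 * (6 - 4 * t + t ^+ 2) by ring.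
  rewrite lerDl mulr_ge0// ?sqr_ge0// addr_ge0 ?sqr_ge0//; lra.
apply: (@le_trans _ _ ((1 + x) * (1 - 4 * x ^+ 4))); last first.
  by rewrite ler_pM2l ?addr_gt0.
have -> : (1 + x) * (1 - 4 * x ^+ 4) = 1 + x ^+ 2 + x * (1 - x - 4 * x ^+ 3 - 4 * x ^+ 4) by ring.
by rewrite lerDl mulr_ge0 ?(ltW x0)//; lra.
Qed.

(* Compares Euler factors: only the primes up to 80 may contribute a factor
   above 1, and there are fewer than 81 of them. *)
Lemma squarefree_divsum_le (R : realType) (a : nat) : squarefree a ->
  divsum_root2 R a * (a%:R / (totient a)%:R) ^+ 4 <=
  32 ^+ 81 * divsum_root4 R a.
Proof.
move=> sa.
have nn4 n : 0 <= divsum_root4 R n by apply: sumr_ge0 => d _; rewrite invr_ge0 sqrtr_ge0.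
have nn2 n : 0 <= divsum_root2 R n by apply: sumr_ge0 => d _; rewrite invr_ge0 sqrtr_ge0.
apply: (@le_trans _ _ (32 ^+ (count (fun p => p <= 80)%N (primes a)) * divsum_root4 R a)).
  elim/squarefree_ind: a / sa => [|p n pp pn sn IH].
    rewrite /= expr0 mul1r /divsum_root2 /divsum_root4 !big_seq1.
    by rewrite /root4 !sqrtr1 (_ : totient 1 = 1%N)// !invr1 !mulr1 expr1n.
  have n0 : (0 < n)%N by case/squarefreeP: sn.
  rewrite /divsum_root2 /divsum_root4 !sum_divisors_primeM//; last 2 first.
  - by move=> d; rewrite /root4 natrM !sqrtrM ?sqrtr_ge0// invfM.
  - by move=> d; rewrite natrM sqrtrM// invfM.
  rewrite -/(divsum_root2 R n) -/(divsum_root4 R n).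
  rewrite totient_coprime ?prime_coprime// totient_prime//.
  have /permP-> : perm_eq (primes (p * n)) (p :: primes n).
    apply: uniq_perm; rewrite /= ?primes_uniq ?mem_primes ?(negPf pn) ?andbF//.
    by move=> r; rewrite primesM ?n0 ?prime_gt0// primes_prime// !inE.
  have -> : (p * n)%:R / (p.-1 * totient n)%:R =
    (p%:R / p.-1%:R) * (n%:R / (totient n)%:R) :> R by rewrite !natrM invfM mulrACA.
  rewrite /= exprD exprMn.
  rewrite [leLHS]mulrACA [leRHS]mulrACA.
  have r40 (x y : nat) : 0 <= (x%:R / y%:R) ^+ 4 :> R.
    by rewrite exprn_ge0// divr_ge0.
  apply: ler_pM; [| |exact: euler_factor_bound|exact: IH].
    by rewrite mulr_ge0// addr_ge0// invr_ge0 sqrtr_ge0.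
  by rewrite mulr_ge0.
rewrite ler_wpM2r//.
apply: ler_weXn2l; first by rewrite ler1n.
rewrite -size_filter -[81%N](size_iota 0).
apply: uniq_leq_size; first exact/filter_uniq/primes_uniq.
by move=> p; rewrite mem_filter mem_iota => /andP[].
Qed.

(* Keeps the constant opaque: unification would otherwise unfold [32 ^+ 81]. *)
Lemma squarefree_divsum_bounded (R : realType) :
  {K : R | 0 < K & forall a, squarefree a ->
    divsum_root2 R a * (a%:R / (totient a)%:R) ^+ 4 <= K * divsum_root4 R a}.
Proof.
by exists (32 ^+ 81) => [|a]; [rewrite exprn_gt0|exact: squarefree_divsum_le].
Qed.

Definition euler_const (R : realType) : R := s2val (squarefree_divsum_bounded R).

Lemma euler_const_gt0 (R : realType) : 0 < euler_const R.
Proof. exact: (s2valP (squarefree_divsum_bounded R)). Qed.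

(** * The weights mu^2 / phi^2 *)

(** A kernel that is a sum over common divisors of [d] and [e] separates the two variables. It is
    applied with [C] the square root, to majorize [sqrt (gcdn d e)], and with [C] the totient, to
    express [gcdn d e] exactly. *)
Lemma sum_common_divisors (R : comPzRingType) (M q r : nat) (A B C : nat -> R) :
  \sum_(d < M.+1 | (d %| q)%N) \sum_(e < M.+1 | (e %| r)%N)
    A d * B e * \sum_(f < M.+1 | (f %| d)%N && (f %| e)%N) C f =
  \sum_(f < M.+1) C f * (\sum_(d < M.+1 | (d %| q)%N && (f %| d)%N) A d) *
    (\sum_(e < M.+1 | (e %| r)%N && (f %| e)%N) B e).
Proof.
transitivity (\sum_(f < M.+1) \sum_(d < M.+1 | (d %| q)%N)
    \sum_(e < M.+1 | (e %| r)%N)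
    if (f %| d)%N && (f %| e)%N then A d * B e * C f else 0).
  rewrite [RHS]exchange_big /=; apply: eq_bigr => d _.
  rewrite [RHS]exchange_big /=; apply: eq_bigr => e _.
  by rewrite mulr_sumr big_mkcond.
apply: eq_bigr => f _.
rewrite [X in C f * X * _]big_mkcondr [X in C f * _ * X]big_mkcondr /=.
rewrite -mulrA big_distrlr mulr_sumr /=; apply: eq_bigr => d _.
rewrite mulr_sumr; apply: eq_bigr => e _.
by case: (f %| d)%N; case: (f %| e)%N; rewrite /= ?mulr0 ?mul0r ?mulr0// mulrC.
Qed.

Definition weight (R : realType) (q : nat) : R :=
  (moebius q)%:~R ^+ 2 / (totient q)%:R ^+ 2.

Lemma sqr_moebius (R : realType) (q : nat) :
  (moebius q)%:~R ^+ 2 = (squarefree q)%:R :> R.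
Proof.
rewrite /moebius; case: ifP => _; last by rewrite expr0n.
by rewrite rmorphXn /= rmorphN1 sqrr_sign.
Qed.

Lemma weight_ge0 (R : realType) (q : nat) : 0 <= weight R q.
Proof. by rewrite /weight divr_ge0// sqr_ge0. Qed.

Lemma weight_squarefree (R : realType) (q : nat) :
  squarefree q -> weight R q = (totient q)%:R ^- 2.
Proof. by move=> sq; rewrite /weight sqr_moebius sq mul1r. Qed.

Lemma weight_nsquarefree (R : realType) (q : nat) :
  ~~ squarefree q -> weight R q = 0.
Proof. by move=> /negPf sq; rewrite /weight sqr_moebius sq mul0r. Qed.

(** Equality holds when [f * a] is squarefree; otherwise the left side is 0. *)
Lemma weightM_le (R : realType) (f a : nat) :
  weight R (f * a) <= weight R f * weight R a.
Proof.
have [s|s] := boolP (squarefree (f * a)); last first.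
  by rewrite weight_nsquarefree// mulr_ge0 ?weight_ge0.
have sf : squarefree f by apply: squarefree_dvd s; rewrite dvdn_mulr.
have sa : squarefree a by apply: squarefree_dvd s; rewrite dvdn_mull.
rewrite !weight_squarefree// totient_coprime ?squarefree_coprime//.
by rewrite natrM exprMn invfM.
Qed.

Lemma divsum_root4_ge0 (R : realType) (n : nat) : 0 <= divsum_root4 R n.
Proof. by apply: sumr_ge0 => d _; rewrite invr_ge0 sqrtr_ge0. Qed.

Lemma divsum_root2_ge1 (R : realType) (n : nat) : (0 < n)%N -> 1 <= divsum_root2 R n.
Proof.
move=> n0; rewrite /divsum_root2 (bigD1_seq 1%N) ?divisors_uniq//=; last first.
  by rewrite -dvdn_divisors.
by rewrite sqrtr1 invr1 lerDl; apply: sumr_ge0 => d _; rewrite invr_ge0 sqrtr_ge0.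
Qed.

Lemma totient_leq (n : nat) : (totient n <= n)%N.
Proof.
rewrite totient_count_coprime big_mkord -[leqRHS]card_ord -sum1_card.
by apply: leq_sum => i _; case: coprime.
Qed.

(** The ratio [a / phi(a)] is at least 1, so its lower powers are controlled by the fourth. *)
Lemma squarefree_divsum_expr_le (R : realType) (a j : nat) :
  squarefree a -> (j <= 4)%N ->
  divsum_root2 R a * (a%:R / (totient a)%:R) ^+ j <=
  euler_const R * divsum_root4 R a.
Proof.
move=> sa j4; apply: le_trans (s2valP' (squarefree_divsum_bounded R) a sa).
have a0 : (0 < a)%N by case/squarefreeP: sa.
rewrite ler_wpM2l//; first by apply: le_trans (divsum_root2_ge1 R a a0).
apply: ler_weXn2l => //.
by rewrite ler_pdivlMr ?ltr0n ?totient_gt0// mul1r ler_nat totient_leq.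
Qed.

Lemma squarefree_expr_le (R : realType) (a j : nat) :
  squarefree a -> (j <= 4)%N ->
  (a%:R / (totient a)%:R) ^+ j <= euler_const R * divsum_root4 R a.
Proof.
move=> sa j4; apply: le_trans (squarefree_divsum_expr_le R a j sa j4).
have a0 : (0 < a)%N by case/squarefreeP: sa.
by rewrite ler_peMl ?divsum_root2_ge1// exprn_ge0// divr_ge0.
Qed.

(** For squarefree [a], [phi(a)^(-2) sqrt a = (a / phi(a))^2 a^(-3/2)]; this brings the term to the
    shape summed in [sum_tail_divsum]. *)
Lemma weight_divsum_le (R : realType) (a : nat) :
  weight R a * (Num.sqrt a%:R * divsum_root2 R a) <=
  euler_const R * (divsum_root4 R a / (a%:R * Num.sqrt a%:R)).
Proof.
have [sa|sa] := boolP (squarefree a); last first.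
  rewrite weight_nsquarefree// mul0r mulr_ge0 ?(ltW (euler_const_gt0 R))//.
  by rewrite divr_ge0 ?divsum_root4_ge0// mulr_ge0// sqrtr_ge0.
have a0 : (0 < a)%N by case/squarefreeP: sa.
have ap : 0 < a%:R :> R by rewrite ltr0n.
have tp : 0 < (totient a)%:R :> R by rewrite ltr0n totient_gt0.
rewrite mulrA ler_pdivlMr ?mulr_gt0 ?sqrtr_gt0//.
apply: le_trans (squarefree_divsum_expr_le R a 2 sa isT).
rewrite weight_squarefree// le_eqVlt; apply/orP; left; apply/eqP.
set s := Num.sqrt _; have -> : a%:R = s ^+ 2 by rewrite sqr_sqrtr// ltW.
by field; rewrite lt0r_neq0.
Qed.

(** Here [phi(a)^(-4) a^(5/2) = (a / phi(a))^4 a^(-3/2)], which uses the full fourth power. *)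
Lemma weight_sqr_le (R : realType) (a : nat) :
  weight R a ^+ 2 * (a%:R ^+ 2 * Num.sqrt a%:R) <=
  euler_const R * (divsum_root4 R a / (a%:R * Num.sqrt a%:R)).
Proof.
have [sa|sa] := boolP (squarefree a); last first.
  rewrite weight_nsquarefree// expr0n mul0r mulr_ge0 ?(ltW (euler_const_gt0 R))//.
  by rewrite divr_ge0 ?divsum_root4_ge0// mulr_ge0// sqrtr_ge0.
have a0 : (0 < a)%N by case/squarefreeP: sa.
have ap : 0 < a%:R :> R by rewrite ltr0n.
have tp : 0 < (totient a)%:R :> R by rewrite ltr0n totient_gt0.
rewrite mulrA ler_pdivlMr ?mulr_gt0 ?sqrtr_gt0//.
apply: le_trans (squarefree_expr_le R a 4 sa isT).
rewrite weight_squarefree// le_eqVlt; apply/orP; left; apply/eqP.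
set s := Num.sqrt _; have -> : a%:R = s ^+ 2 by rewrite sqr_sqrtr// ltW.
by field; rewrite lt0r_neq0.
Qed.

(** Only [q = f a] contribute, and then the inner sum is at most [sqrt f * sqrt a] times
    sigma_{-1/2}(a). Splitting off [weight R f] leaves a tail over [a > m / f], of size
    [sqrt (f / m)]; the two factors [sqrt f] make up the [f] of the bound. *)
Lemma sum_weight_multiples_le (R : realType) (M m f : nat) :
  (0 < m)%N -> (0 < f)%N ->
  \sum_(q < M.+1 | (m < q)%N) weight R q *
    (\sum_(d < M.+1 | (d %| q)%N && (f %| d)%N) Num.sqrt d%:R) <=
  weight R f * f%:R * (euler_const R * 120 / Num.sqrt m%:R).
Proof.
move=> m0 f0; have fp : 0 < f%:R :> R by rewrite ltr0n.
have mp : 0 < m%:R :> R by rewrite ltr0n.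
pose b q : R := weight R q * (Num.sqrt q%:R * divsum_root2 R (q %/ f)).
apply: (@le_trans _ _ (\sum_(q < M.+1 | (f %| q)%N && (m < q)%N) b q)).
  rewrite big_mkcond [leRHS]big_mkcond; apply: ler_sum => q _ /=.
  have [mq|_] := boolP (m < q)%N; last by rewrite andbF.
  have q0 : (0 < q)%N by apply: leq_ltn_trans mq.
  rewrite andbT; have [fq|fq] := boolP (f %| q)%N; last first.
    rewrite big1 ?mulr0// => d /andP[dq fd].
    by case/negP: fq; apply: dvdn_trans dq.
  rewrite ler_wpM2l ?weight_ge0//.
  have qM : (0 < q <= M)%N by rewrite q0 -ltnS ltn_ord.
  (* Passing to [q / d] turns [f | d] into [d | q / f] and [sqrt d] into [sqrt q / sqrt d]. *)
  rewrite (sum_codivisors _ M q (fun d => (f %| d)%N) (fun d => Num.sqrt d%:R))//.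
  have qf : (0 < q %/ f <= M)%N.
    rewrite divn_gt0// dvdn_leq//= (leq_trans (leq_div _ _))//.
    by case/andP: qM.
  rewrite /divsum_root2 (sum_divisors_ord _ M _ (fun d => (Num.sqrt d%:R)^-1))//.
  rewrite mulr_sumr big_mkcond [leRHS]big_mkcond /=; apply: ler_sum => d _.
  case: ifP => [/andP[dq fd]|_].
    rewrite (_ : (d %| q %/ f)%N); last first.
      by rewrite -(dvdn_pmul2r f0) divnK// mulnC -(divnK dq) dvdn_pmul2r// (dvdn_gt0 q0 dq).
    rewrite -sqrtrV// -sqrtrM// ler_wsqrtr//.
    have dp : 0 < d%:R :> R by rewrite ltr0n (dvdn_gt0 q0 dq).
    by rewrite ler_pdivlMr// -natrM divnK.
  by case: ifP => // _; rewrite mulr_ge0 ?invr_ge0 ?sqrtr_ge0.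
rewrite (sum_multiples _ M f (fun q => (m < q)%N) b)//.
apply: (@le_trans _ _ (\sum_(a < M.+1 | m%:R / f%:R < a%:R :> R)
   weight R f * Num.sqrt f%:R * (euler_const R * (divsum_root4 R a / (a%:R * Num.sqrt a%:R))))).
  have F0 a : 0 <= weight R f * Num.sqrt f%:R * (euler_const R * (divsum_root4 R a / (a%:R * Num.sqrt a%:R))).
    rewrite mulr_ge0 ?(mulr_ge0 (weight_ge0 R f)) ?sqrtr_ge0//.
    by rewrite mulr_ge0 ?(ltW (euler_const_gt0 R))// divr_ge0 ?divsum_root4_ge0// mulr_ge0// sqrtr_ge0.
  rewrite big_mkcond [leRHS]big_mkcond; apply: ler_sum => a _ /=.
  rewrite ltr_pdivrMr// -natrM ltr_nat mulnC.
  have [mf|_] := boolP (m < a * f)%N; last by rewrite andbF.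
  case: ifP => _ //.
  rewrite /b mulnK// mulnC natrM sqrtrM//.
  apply: (@le_trans _ _ (weight R f * weight R a *
     (Num.sqrt f%:R * Num.sqrt a%:R * divsum_root2 R a))).
    rewrite ler_wpM2r ?weightM_le// !mulr_ge0 ?sqrtr_ge0//.
    by apply: sumr_ge0 => d _; rewrite invr_ge0 sqrtr_ge0.
  have -> : weight R f * weight R a * (Num.sqrt f%:R * Num.sqrt a%:R * divsum_root2 R a)
    = weight R f * Num.sqrt f%:R * (weight R a * (Num.sqrt a%:R * divsum_root2 R a)).
    by ring.
  rewrite (ler_wpM2l (mulr_ge0 (weight_ge0 R f) (sqrtr_ge0 _)))//.
  exact: weight_divsum_le.
rewrite -!mulr_sumr -[leRHS]mulrA -[leLHS]mulrA (ler_wpM2l (weight_ge0 R f))//.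
have zp : 0 < m%:R / f%:R :> R by rewrite divr_gt0.
have h := ler_wpM2l (mulr_ge0 (sqrtr_ge0 f%:R) (ltW (euler_const_gt0 R)))
  (sum_tail_divsum R _ M zp).
rewrite mulrA; apply: (le_trans h).
rewrite sqrtrM ?(ltW mp)// sqrtrV ?(ltW fp)// invfM invrK.
rewrite le_eqVlt; apply/orP; left; apply/eqP.
rewrite -[X in _ = X * _](sqr_sqrtr (ltW fp)).
by field; rewrite lt0r_neq0// sqrtr_gt0.
Qed.

(** * Off-diagonal terms and orthogonality *)

(** The squared constant of [sum_weight_multiples_le] times the bound of [sum_weight_sqr_le]. *)
Definition offdiag_const (R : realType) : R := 240 * 120 ^+ 2 * euler_const R ^+ 3.

Lemma offdiag_const_gt0 (R : realType) : 0 < offdiag_const R.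
Proof. by rewrite mulr_gt0 ?mulr_gt0 ?exprn_gt0 ?euler_const_gt0. Qed.

Lemma sum_weight_sqr_le (R : realType) (M : nat) :
  \sum_(f < M.+1 | (0 < f)%N) weight R f ^+ 2 * (f%:R ^+ 2 * Num.sqrt f%:R) <=
  240 * euler_const R.
Proof.
(* Any cutoff strictly between 0 and 1 selects all positive integers; a square makes the root
   explicit, and [120 / (1 / 2) = 240]. *)
have h := sum_tail_divsum R ((1 / 2) ^+ 2) M (exprn_gt0 2 (divr_gt0 ltr01 (ltr0n R 2))).
apply: (@le_trans _ _ (\sum_(f < M.+1 | (1 / 2) ^+ 2 < f%:R :> R)
    euler_const R * (divsum_root4 R f / (f%:R * Num.sqrt f%:R)))).
  rewrite (eq_bigl (fun f : 'I_M.+1 => (1 / 2) ^+ 2 < f%:R :> R)) => [|f].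
    by apply: ler_sum => f _; exact: weight_sqr_le.
  have q0 : 0 < (1 / 2 : R) ^+ 2 by rewrite exprn_gt0 ?divr_gt0.
  have q1 : (1 / 2 : R) ^+ 2 < 1.
    by rewrite expr_lt1// ?ltr_pdivrMr ?mul1r ?ltr1n// divr_ge0.
  have [->|f0] := posnP f; first by rewrite [RHS]ltNge ltW.
  by apply/esym/(lt_le_trans q1); rewrite ler1n.
rewrite -mulr_sumr mulrC (le_trans (ler_wpM2r (ltW (euler_const_gt0 R)) h))//.
rewrite sqrtr_sqr ger0_norm ?divr_ge0//.
have -> : 120 / (1 / 2) = 240 :> R by field.
exact: lexx.
Qed.

(** This is the total rounding cost without its factor [sqrt n], because [d e / sqrt [d,e] = sqrt (d
    e (d,e))]. Once the kernel is separated, the sum is at most that of [sqrt f * g(f)^2], with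
    [g(f)] bounded by [sum_weight_multiples_le]. *)
Lemma sum_gcd_weight_le (R : realType) (M m : nat) : (0 < m)%N ->
  \sum_(q < M.+1 | (m < q)%N) \sum_(r < M.+1 | (m < r)%N)
    weight R q * weight R r *
    (\sum_(d < M.+1 | (d %| q)%N) \sum_(e < M.+1 | (e %| r)%N)
       Num.sqrt d%:R * Num.sqrt e%:R * Num.sqrt (gcdn d e)%:R)
  <= offdiag_const R / m%:R.
Proof.
move=> m0; have mp : 0 < m%:R :> R by rewrite ltr0n.
pose b f q : R := \sum_(d < M.+1 | (d %| q)%N && (f %| d)%N) Num.sqrt d%:R.
have b0 f q : 0 <= b f q by apply: sumr_ge0 => d _; apply: sqrtr_ge0.
pose g f : R := \sum_(q < M.+1 | (m < q)%N) weight R q * b f q.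
have g0 f : 0 <= g f by apply: sumr_ge0 => q _; rewrite mulr_ge0 ?weight_ge0.
apply: (@le_trans _ _ (\sum_(f < M.+1) Num.sqrt f%:R * g f ^+ 2)).
  apply: (@le_trans _ _ (\sum_(q < M.+1 | (m < q)%N) \sum_(r < M.+1 | (m < r)%N)
     weight R q * weight R r * \sum_(f < M.+1) Num.sqrt f%:R * b f q * b f r)).
    apply: ler_sum => q mq; apply: ler_sum => r mr.
    rewrite (ler_wpM2l (mulr_ge0 (weight_ge0 R q) (weight_ge0 R r)))//.
    rewrite -(sum_common_divisors _ M q r (fun d => Num.sqrt d%:R)
      (fun d => Num.sqrt d%:R) (fun d => Num.sqrt d%:R)).
    apply: ler_sum => d dq; apply: ler_sum => e er.
    have d0 : (0 < d)%N by apply: dvdn_gt0 dq; apply: leq_ltn_trans mq.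
    have gM : (gcdn d e < M.+1)%N.
      by apply: leq_ltn_trans (ltn_ord d); rewrite dvdn_leq ?dvdn_gcdl.
    rewrite ler_wpM2l ?mulr_ge0 ?sqrtr_ge0//.
    (* The single term [f = gcdn d e] already accounts for the left side. *)
    rewrite (bigD1 (Ordinal gM)) /= ?dvdn_gcdl ?dvdn_gcdr// lerDl.
    by apply: sumr_ge0 => f _; apply: sqrtr_ge0.
  rewrite le_eqVlt; apply/orP; left; apply/eqP.
  transitivity (\sum_(f < M.+1) \sum_(q < M.+1 | (m < q)%N) \sum_(r < M.+1 | (m < r)%N)
     weight R q * weight R r * (Num.sqrt f%:R * b f q * b f r)).
    rewrite [RHS]exchange_big /=; apply: eq_bigr => q _.
    rewrite [RHS]exchange_big /=; apply: eq_bigr => r _.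
    by rewrite mulr_sumr.
  apply: eq_bigr => f _; rewrite expr2 /g big_distrlr mulr_sumr /=.
  apply: eq_bigr => q _; rewrite [RHS]mulr_sumr; apply: eq_bigr => r _; ring.
rewrite (bigID (fun f : 'I_M.+1 => (0 < f)%N)) /= addrC big1 ?add0r => [|f]; last first.
  by rewrite -eqn0Ngt => /eqP->; rewrite sqrtr0 mul0r.
set B := euler_const R * 120 / Num.sqrt m%:R.
apply: (@le_trans _ _ (\sum_(f < M.+1 | (0 < f)%N)
   B ^+ 2 * (weight R f ^+ 2 * (f%:R ^+ 2 * Num.sqrt f%:R)))).
  apply: ler_sum => f f0.
  have -> : B ^+ 2 * (weight R f ^+ 2 * (f%:R ^+ 2 * Num.sqrt f%:R)) =
    Num.sqrt f%:R * (weight R f * f%:R * B) ^+ 2 by ring.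
  rewrite ler_wpM2l ?sqrtr_ge0// ler_pXn2r// ?nnegrE//.
    exact: sum_weight_multiples_le.
  apply: le_trans (sum_weight_multiples_le R M m f m0 f0).
  exact: g0.
rewrite -mulr_sumr (le_trans (ler_wpM2l (sqr_ge0 B) (sum_weight_sqr_le R M)))//.
rewrite le_eqVlt; apply/orP; left; apply/eqP.
rewrite /B /offdiag_const exprMn exprVn sqr_sqrtr ?(ltW mp)//.
by field; rewrite lt0r_neq0.
Qed.

(** The fractional part [t] of [n / l] satisfies [t^2 <= t <= n / l]. Unlike the trivial bound 1,
    the square root decays in [l], which makes the later sums converge. *)
Lemma floor_divn_dist (R : realType) (n l : nat) : (0 < l)%N ->
  `|(n %/ l)%N%:R - n%:R / l%:R| <= Num.sqrt (n%:R / l%:R) :> R.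
Proof.
move=> l0; have lp : 0 < l%:R :> R by rewrite ltr0n.
have -> : (n %/ l)%N%:R - n%:R / l%:R = - ((n %% l)%N%:R / l%:R) :> R.
  rewrite {2}(divn_eq n l) natrD natrM; field.
  by rewrite lt0r_neq0.
rewrite normrN -sqrtr_sqr ler_wsqrtr// expr2.
apply: (@le_trans _ _ (1 * ((n %% l)%N%:R / l%:R))).
  rewrite ler_wpM2r ?divr_ge0// ler_pdivrMr// mul1r ler_nat ltnW//.
  by rewrite ltn_mod.
by rewrite mul1r ler_pM2r ?invr_gt0// ler_nat leq_mod.
Qed.

Lemma natr_gcd_lcm (R : numFieldType) (d e : nat) : (0 < d)%N -> (0 < e)%N ->
  d%:R * e%:R / (lcmn d e)%:R = (gcdn d e)%:R :> R.
Proof.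
move=> d0 e0; rewrite -natrM -muln_lcm_gcd natrM mulrAC divff ?mul1r//.
by rewrite pnatr_eq0 -lt0n lcmn_gt0 d0.
Qed.

(** Gauss's identity for [gcdn d e], in the shape required by [sum_common_divisors]. *)
Lemma sum_totient_common_divisors (R : pzSemiRingType) (M d e : nat) : (0 < d <= M)%N ->
  \sum_(f < M.+1 | (f %| d)%N && (f %| e)%N) (totient f)%:R = (gcdn d e)%:R :> R.
Proof.
move=> /andP[d0 dM]; rewrite -natr_sum; congr _%:R.
have g0 : (0 < gcdn d e)%N by rewrite gcdn_gt0 d0.
have gM : (gcdn d e < M.+1)%N by rewrite ltnS (leq_trans _ dM)// dvdn_leq// dvdn_gcdl.
rewrite -[RHS]sum_totient_dvd (big_ord_widen_cond M.+1 (fun f => f %| gcdn d e)%N totient)//.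
apply: eq_bigl => f; rewrite -dvdn_gcd; case fg: (f %| _)%N => //=.
by rewrite ltnS dvdn_leq.
Qed.

(** Since [d e / [d,e] = (d,e)] is the sum of [totient f] over common divisors, the variables
    separate, and Moebius inversion turns the two inner sums into the indicators of [f = q] and
    [f = r]. *)
Lemma ramanujan_orthogonality (R : realType) (M q r : nat) :
  (0 < q <= M)%N -> (0 < r <= M)%N ->
  \sum_(d < M.+1 | (d %| q)%N) \sum_(e < M.+1 | (e %| r)%N)
    (d%:R * (moebius (q %/ d))%:~R) * (e%:R * (moebius (r %/ e))%:~R) / (lcmn d e)%:R
  = (if q == r then (totient q)%:R else 0) :> R.
Proof.
move=> qM rM; have /andP[q0 _] := qM; have /andP[r0 _] := rM.
transitivity (\sum_(d < M.+1 | (d %| q)%N) \sum_(e < M.+1 | (e %| r)%N)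
   (moebius (q %/ d))%:~R * (moebius (r %/ e))%:~R *
   (\sum_(f < M.+1 | (f %| d)%N && (f %| e)%N) (totient f)%:R) : R).
  apply: eq_bigr => d dq; apply: eq_bigr => e er.
  have d0 := dvdn_gt0 q0 dq; have e0 := dvdn_gt0 r0 er.
  have dM : (0 < d <= M)%N by rewrite d0 -ltnS ltn_ord.
  rewrite (sum_totient_common_divisors R M d e dM).
  by rewrite -natr_gcd_lcm//; ring.
rewrite (sum_common_divisors _ M q r (fun d => (moebius (q %/ d))%:~R)
  (fun e => (moebius (r %/ e))%:~R) (fun f => (totient f)%:R)).
have inner (n : nat) (f : 'I_M.+1) : (0 < f)%N -> (0 < n <= M)%N ->
    \sum_(d < M.+1 | (d %| n)%N && (f %| d)%N) (moebius (n %/ d))%:~R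
      = (nat_of_ord f == n)%:R :> R.
  move=> f0 nM; rewrite -(rmorph_sum (intr : int -> R)) /=.
  by rewrite sum_moebius_interval//; case: eqP.
have qlt : (q < M.+1)%N by case/andP: qM.
rewrite (bigD1 (Ordinal qlt)) //= (inner q (Ordinal qlt))//.
rewrite (inner r (Ordinal qlt))//= eqxx mulr1 big1 => [|f fq].
  by rewrite addr0; case: eqP => _; rewrite ?mulr1 ?mulr0.
(* Index 0 lies outside the scope of [inner], but [totient 0 = 0]. *)
have [->|f0] := posnP f; first by rewrite !mul0r.
rewrite inner// (_ : (nat_of_ord f == q) = false) ?mulr0 ?mul0r//.
by apply: contra_neqF fq => /eqP fq; apply: val_inj.
Qed.

(** * The truncated second moment *)

Lemma sum_dvd_pair (R : pzSemiRingType) (n d e : nat) :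
  \sum_(1 <= k < n.+1) ((d %| k)%N && (e %| k)%N)%:R = (n %/ lcmn d e)%N%:R :> R.
Proof.
rewrite divn_count_dvd natr_sum; apply: eq_bigr => k _.
by rewrite dvdn_lcm.
Qed.

Lemma variance_finite (R : realType) (M m n : nat) : (0 < m)%N ->
  `|\sum_(1 <= k < n.+1) (\sum_(q < M.+1 | (m < q)%N) weight R q *
       (\sum_(d < M.+1 | (d %| q)%N && (d %| k)%N) d%:R * (moebius (q %/ d))%:~R)) ^+ 2
    - n%:R * \sum_(q < M.+1 | (m < q)%N) weight R q ^+ 2 * (totient q)%:R|
  <= offdiag_const R / m%:R * Num.sqrt n%:R.
Proof.
move=> m0.
pose a q d : R := d%:R * (moebius (q %/ d))%:~R.
(* Both compared quantities are values of this linear functional of the kernel [h]: the second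
   moment at the exact count of [k], the main term at [n / [d,e]]. Their difference is thus [W] of
   the rounding error. *)
pose W (h : nat -> nat -> R) : R :=
  \sum_(q < M.+1 | (m < q)%N) \sum_(r < M.+1 | (m < r)%N) weight R q * weight R r *
    (\sum_(d < M.+1 | (d %| q)%N) \sum_(e < M.+1 | (e %| r)%N) a q d * a r e * h d e).
have WB h1 h2 : W h1 - W h2 = W (fun d e => h1 d e - h2 d e).
  rewrite /W -sumrB; apply: eq_bigr => q _; rewrite -sumrB; apply: eq_bigr => r _.
  rewrite -mulrBr; congr (_ * _).
  rewrite -sumrB; apply: eq_bigr => d _; rewrite -sumrB; apply: eq_bigr => e _.
  by rewrite mulrBr.
have -> : \sum_(1 <= k < n.+1) (\sum_(q < M.+1 | (m < q)%N) weight R q *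
     (\sum_(d < M.+1 | (d %| q)%N && (d %| k)%N) a q d)) ^+ 2 =
   W (fun d e => (n %/ lcmn d e)%N%:R).
  transitivity (\sum_(1 <= k < n.+1)
      W (fun d e => ((d %| k)%N && (e %| k)%N)%:R)).
    apply: eq_bigr => k _; rewrite expr2 big_distrlr /=.
    apply: eq_bigr => q _; apply: eq_bigr => r _; rewrite mulrACA; congr (_ * _).
    rewrite [X in X * _]big_mkcondr [X in _ * X]big_mkcondr big_distrlr /=.
    apply: eq_bigr => d _; apply: eq_bigr => e _.
    by case: (d %| k)%N; case: (e %| k)%N; rewrite /= ?mulr1 ?mulr0 ?mul0r.
  rewrite /W exchange_big /=; apply: eq_bigr => q _.
  rewrite exchange_big /=; apply: eq_bigr => r _.
  rewrite -mulr_sumr exchange_big /=; congr (_ * _); apply: eq_bigr => d _.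
  rewrite exchange_big /=; apply: eq_bigr => e _.
  by rewrite -mulr_sumr sum_dvd_pair.
have -> : n%:R * \sum_(q < M.+1 | (m < q)%N) weight R q ^+ 2 * (totient q)%:R =
   W (fun d e => n%:R / (lcmn d e)%:R).
  rewrite /W mulr_sumr; apply: eq_bigr => q mq.
  (* By orthogonality only [r = q] survives, with value [totient q]. *)
  rewrite (bigD1 q)//= [X in _ + X]big1 => [|r /andP[mr rq]].
    rewrite addr0.
    have -> : n%:R * (weight R q ^+ 2 * (totient q)%:R) =
      weight R q * weight R q * (n%:R * (totient q)%:R) by ring.
    congr (_ * _).
    transitivity (n%:R * \sum_(d < M.+1 | (d %| q)%N) \sum_(e < M.+1 | (e %| q)%N)
       a q d * a q e / (lcmn d e)%:R).
      have qM : (0 < q <= M)%N by rewrite (leq_ltn_trans _ mq)// -ltnS ltn_ord.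
      by rewrite (ramanujan_orthogonality R M q q qM qM) eqxx.
    rewrite mulr_sumr; apply: eq_bigr => d _; rewrite mulr_sumr; apply: eq_bigr => e _.
    by rewrite mulrCA.
  have qM : (0 < q <= M)%N by rewrite (leq_ltn_trans _ mq)// -ltnS ltn_ord.
  have rM : (0 < r <= M)%N by rewrite (leq_ltn_trans _ mr)// -ltnS ltn_ord.
  have := ramanujan_orthogonality R M q r qM rM.
  rewrite ifF => [h|]; last by apply: contra_neqF rq => /eqP qr; apply: val_inj.
  apply/eqP; rewrite mulf_eq0; apply/orP; right; apply/eqP.
  transitivity (n%:R * \sum_(d < M.+1 | (d %| q)%N) \sum_(e < M.+1 | (e %| r)%N)
     a q d * a r e / (lcmn d e)%:R); last by rewrite [X in _ * X]h mulr0.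
  rewrite mulr_sumr; apply: eq_bigr => d _.
  by rewrite mulr_sumr; apply: eq_bigr => e _; rewrite [RHS]mulrCA.
rewrite WB; apply: (le_trans (ler_norm_sum _ _ _)).
apply: le_trans (ler_wpM2r (sqrtr_ge0 n%:R) (sum_gcd_weight_le R M m m0)).
rewrite mulr_suml; apply: ler_sum => q mq.
apply: (le_trans (ler_norm_sum _ _ _)).
rewrite mulr_suml; apply: ler_sum => r mr.
have q0 : (0 < q)%N by apply: leq_ltn_trans mq.
have r0 : (0 < r)%N by apply: leq_ltn_trans mr.
have w0 := mulr_ge0 (weight_ge0 R q) (weight_ge0 R r).
rewrite normrM (ger0_norm w0) -[leRHS]mulrA (ler_wpM2l w0)//.
apply: (le_trans (ler_norm_sum _ _ _)).
rewrite mulr_suml; apply: ler_sum => d dq.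
apply: (le_trans (ler_norm_sum _ _ _)).
rewrite mulr_suml; apply: ler_sum => e er.
have d0 := dvdn_gt0 q0 dq; have e0 := dvdn_gt0 r0 er.
have l0 : (0 < lcmn d e)%N by rewrite lcmn_gt0 d0.
have mu1 (k : nat) : `|(moebius k)%:~R| <= 1 :> R.
  rewrite -(@ler_pXn2r _ 2) ?nnegrE// expr1n -normrX sqr_moebius.
  by case: squarefree; rewrite ?normr1 ?normr0.
have aa q' (d' : nat) : `|a q' d'| <= d'%:R.
  by rewrite /a normrM normr_nat ler_piMr.
rewrite normrM; apply: (@le_trans _ _ (d%:R * e%:R * Num.sqrt (n%:R / (lcmn d e)%:R))).
  apply: ler_pM; rewrite ?floor_divn_dist//.
  by rewrite normrM; apply: ler_pM.
(* Here [d e sqrt (n / [d,e])] becomes [sqrt n * sqrt d * sqrt e * sqrt (d,e)]. *)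
rewrite -natr_gcd_lcm//.
have dp : 0 < d%:R :> R by rewrite ltr0n.
have ep : 0 < e%:R :> R by rewrite ltr0n.
rewrite !sqrtrM ?mulr_ge0 ?ler0n//.
rewrite -{1}(sqr_sqrtr (ltW dp)) -{1}(sqr_sqrtr (ltW ep)).
by rewrite le_eqVlt; apply/orP; left; apply/eqP; ring.
Qed.

(** * The tail of mu^2 / phi^3 *)

Lemma sum_nat1_truncn (R : realType) (y : R) (M : nat) (F : nat -> R) : 0 <= y ->
  \sum_(1 <= q < M.+1 | y < q%:R) F q = \sum_(q < M.+1 | (Num.truncn y < q)%N) F q.
Proof.
move=> y0; rewrite (big_nat1_ord _ _ (fun q => y < q%:R)); apply: eq_bigl => q.
rewrite truncn_lt_nat//; case: (nat_of_ord q) => [|q']//.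
by apply/esym/negP; rewrite ltNge y0.
Qed.

(** Absolute convergence: the partial sums of absolute values increase and stay below [C]. *)
Lemma cvgn_tail_sum (R : realType) (y C : R) (F : nat -> R) : 0 <= y ->
  (forall M, \sum_(q < M.+1 | (Num.truncn y < q)%N) `|F q| <= C) ->
  cvgn (fun n => \sum_(1 <= q < n | y < q%:R) F q).
Proof.
move=> y0 FC; pose u q : R := if (Num.truncn y < q)%N then F q else 0.
have -> : (fun n => \sum_(1 <= q < n | y < q%:R) F q) = series u.
  apply/funext => -[|n]; first by rewrite /series /= !big_geq.
  by rewrite sum_nat1_truncn// big_mkcond /series /= big_mkord.
apply: normed_cvg; apply: nondecreasing_is_cvgn.
  apply/nondecreasing_seqP => n.
  by rewrite /normed_series_of seriesSr lerDl normr_ge0.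
exists C => _ [n _ <-]; apply: le_trans (FC n).
rewrite /normed_series_of seriesEord /= [leRHS]big_mkcond big_ord_recr /=.
apply: (@le_trans _ _ (\sum_(i < n) if (Num.truncn y < i)%N then `|F i| else 0)).
  apply: ler_sum => i _; rewrite /u; case: ifP => // _; by rewrite normr0.
by rewrite lerDl; case: ifP.
Qed.

Lemma weight_sqr_totient (R : realType) (q : nat) : (0 < q)%N ->
  weight R q ^+ 2 * (totient q)%:R = (moebius q)%:~R ^+ 2 / (totient q)%:R ^+ 3.
Proof.
move=> q0; have t0 : 0 < (totient q)%:R :> R by rewrite ltr0n totient_gt0.
rewrite sqr_moebius; have [sq|sq] := boolP (squarefree q).
  by rewrite weight_squarefree// mul1r; field; rewrite lt0r_neq0.
by rewrite weight_nsquarefree// expr0n /= !mul0r.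
Qed.

Lemma sum_tail_divsum_nat (R : realType) (M m : nat) : (0 < m)%N ->
  \sum_(q < M.+1 | (m < q)%N) divsum_root4 R q / (q%:R * Num.sqrt q%:R) <=
  120 / Num.sqrt m%:R.
Proof.
move=> m0; have := sum_tail_divsum R m%:R M; rewrite ltr0n => /(_ m0).
by under eq_bigl do rewrite ltr_nat.
Qed.

(** Inserting the factors [sqrt q] and [divsum_root2 R q], both at least 1, is wasteful but enough
    for convergence. *)
Lemma sum_weight_le (R : realType) (M m : nat) : (0 < m)%N ->
  \sum_(q < M.+1 | (m < q)%N) weight R q <= euler_const R * (120 / Num.sqrt m%:R).
Proof.
move=> m0; have K0 := euler_const_gt0 R.
apply: le_trans (ler_wpM2l (ltW K0) (sum_tail_divsum_nat R M m m0)).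
rewrite mulr_sumr; apply: ler_sum => q mq.
apply: le_trans (weight_divsum_le R q).
have q0 : (0 < q)%N by apply: leq_ltn_trans mq.
rewrite ler_peMr ?weight_ge0//.
have : 1 * 1 <= Num.sqrt q%:R * divsum_root2 R q.
  apply: ler_pM => //; last exact: divsum_root2_ge1.
  by rewrite -[leLHS]sqrtr1; apply: ler_wsqrtr; rewrite ler1n.
by rewrite mulr1.
Qed.

(** For squarefree [q > m], write [phi(q)^(-3) = (q / phi(q))^3 q^(-3)] and bound one half of
    [q^(-3)] by [m^(-3/2)]; the tail of the other half gives the remaining [m^(-1/2)]. *)
Lemma sum_weight_sqr_totient_le (R : realType) (M m : nat) : (0 < m)%N ->
  \sum_(q < M.+1 | (m < q)%N) weight R q ^+ 2 * (totient q)%:R <=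
  120 * euler_const R / m%:R ^+ 2.
Proof.
move=> m0; have K0 := euler_const_gt0 R; have mp : 0 < m%:R :> R by rewrite ltr0n.
have sm0 : 0 < Num.sqrt m%:R :> R by rewrite sqrtr_gt0.
have -> : 120 * euler_const R / m%:R ^+ 2 =
  euler_const R / (m%:R * Num.sqrt m%:R) * (120 / Num.sqrt m%:R).
  set s := Num.sqrt _ in sm0 *; have -> : m%:R = s ^+ 2 by rewrite sqr_sqrtr// ltW.
  by field; rewrite lt0r_neq0.
have c0 : 0 <= euler_const R / (m%:R * Num.sqrt m%:R).
  by rewrite divr_ge0 ?(ltW K0)// mulr_ge0// ltW.
apply: le_trans (ler_wpM2l c0 (sum_tail_divsum_nat R M m m0)).
rewrite mulr_sumr; apply: ler_sum => q mq.
have q0 : (0 < q)%N by apply: leq_ltn_trans mq.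
have qp : 0 < q%:R :> R by rewrite ltr0n.
have tp : 0 < (totient q)%:R :> R by rewrite ltr0n totient_gt0.
have sq0 : 0 < Num.sqrt q%:R :> R by rewrite sqrtr_gt0.
have [sf|sf] := boolP (squarefree q); last first.
  rewrite weight_nsquarefree// expr0n mul0r mulr_ge0//.
  by rewrite divr_ge0 ?divsum_root4_ge0// mulr_ge0// ltW.
have h := squarefree_expr_le R q 3 sf isT.
rewrite weight_squarefree//.
have -> : ((totient q)%:R ^- 2) ^+ 2 * (totient q)%:R =
  (q%:R / (totient q)%:R) ^+ 3 / ((q%:R * Num.sqrt q%:R) * (q%:R * Num.sqrt q%:R)) :> R.
  set s := Num.sqrt _ in sq0 *; have -> : q%:R = s ^+ 2 by rewrite sqr_sqrtr// ltW.
  by field; rewrite !lt0r_neq0.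
set Q := q%:R * Num.sqrt _; have Q0 : 0 < Q by rewrite mulr_gt0.
set P := m%:R * Num.sqrt _; have P0 : 0 < P by rewrite mulr_gt0.
have PQ : P <= Q.
  apply: ler_pM; rewrite ?ltW ?sqrtr_gt0// ?ltr_nat//.
  by rewrite ltr_sqrt// ltr_nat.
apply: (@le_trans _ _ (euler_const R * divsum_root4 R q / (Q * Q))).
  by rewrite ler_wpM2r// invr_ge0 mulr_ge0// ltW.
have -> : euler_const R * divsum_root4 R q / (Q * Q) =
  euler_const R * (divsum_root4 R q / Q) * Q^-1 by field; rewrite lt0r_neq0.
rewrite [leRHS]mulrAC ler_wpM2l ?lef_pV2 ?posrE//.
by rewrite mulr_ge0 ?(ltW K0)// divr_ge0 ?divsum_root4_ge0// ltW.
Qed.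

(* 1 / b^2 <= 1 / (b - 1/2) - 1 / (b + 1/2); truncated subtraction makes the
   telescoping function vanish at b = 0. *)
Lemma sum_inv_sqr_le (R : realType) (B : nat) :
  \sum_(b < B | (1 < b)%N) (b%:R ^+ 2)^-1 <= 2 / 3 :> R.
Proof.
apply: (sum_tail_telescope _ (fun b => (b%:R ^+ 2)^-1 : R)
  (fun b => 2 / (b.*2.-1)%:R) 1%N) => b; last by rewrite divr_ge0.
move=> b0; have b1 : 1 <= b%:R :> R by rewrite ler1n.
have -> : (b.+1.*2.-1)%:R = 2 * b%:R + 1 :> R by rewrite doubleS /= -muln2 -natr1 natrM mulrC.
have -> : (b.*2.-1)%:R = 2 * b%:R - 1 :> R.
  by rewrite -subn1 natrB ?double_gt0// -muln2 natrM mulrC.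
have -> : 2 / (2 * b%:R - 1) - 2 / (2 * b%:R + 1) = (b%:R ^+ 2 - 1 / 4)^-1 :> R.
  have e1 : 0 < 2 * b%:R - 1 :> R by lra.
  have e2 : 0 < 2 * b%:R + 1 :> R by lra.
  have -> : b%:R ^+ 2 - 1 / 4 = (2 * b%:R - 1) * (2 * b%:R + 1) / 4 :> R by field.
  by field; rewrite !lt0r_neq0.
have b2 : 1 <= b%:R ^+ 2 :> R by rewrite expr_ge1.
rewrite lef_pV2 ?posrE; lra.
Qed.

(* Of the 19 m integers in (m, 20 m], at most 20 m * (2/3) are divisible by the
   square of some d > 1. *)
Lemma squarefree_count_ge (R : realType) (m : nat) : (0 < m)%N ->
  5%:R * m%:R <= \sum_(q < (20 * m).+1 | (m < q)%N) (squarefree q)%:R :> R.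
Proof.
move=> m0; set M := (20 * m)%N.
have mp : 0 < m%:R :> R by rewrite ltr0n.
have nsf (q : 'I_M.+1) : (m < q)%N ->
    1 - \sum_(d < M.+1 | (1 < d)%N) (d ^ 2 %| q)%N%:R <= (squarefree q)%:R :> R.
  move=> mq; have q0 : (0 < q)%N by apply: leq_ltn_trans mq.
  have [sq|sq] := boolP (squarefree q); first by rewrite gerBl sumr_ge0.
  suff [d d1 dq] : exists2 d : 'I_M.+1, (1 < d)%N & (d ^ 2 %| q)%N.
    by rewrite (bigD1 d)//= dq opprD addrA subrr add0r oppr_le0 sumr_ge0.
  move: sq; rewrite /squarefree q0 /= -has_predC => /hasP[p].
  rewrite mem_primes q0 /= => /andP[pp pq]; rewrite negbK => p2.
  have pM : (p < M.+1)%N by apply: leq_ltn_trans (ltn_ord q); apply: dvdn_leq.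
  by exists (Ordinal pM) => //=; apply: prime_gt1.
apply: (@le_trans _ _ (\sum_(q < M.+1 | (m < q)%N)
  (1 - \sum_(d < M.+1 | (1 < d)%N) (d ^ 2 %| q)%N%:R))); last exact: ler_sum.
rewrite sumrB.
have -> : \sum_(q < M.+1 | (m < q)%N) 1 = 19 * m%:R :> R.
  rewrite -(big_mkord (fun q => m < q)%N (fun=> 1)).
  rewrite (big_cat_nat _ (n := m.+1))//=; last by rewrite ltnS /M leq_pmull.
  rewrite big_nat_cond big1 => [|i]; last by case/andP=> /andP[_]; rewrite ltnS leqNgt => /negPf->.
  rewrite add0r big_nat_cond (eq_bigl (fun i => m < i < M.+1)%N); last first.
    by move=> i; case: (m < i)%N; rewrite ?andbT ?andbF.
  rewrite -big_nat sumr_const_nat subSS /M.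
  by rewrite (_ : (20 * m - m = 19 * m)%N) ?natrM//; lia.
(* What remains is [20 * (2/3) <= 19 - 5]. *)
rewrite lerBrDl -lerBrDr.
apply: (@le_trans _ _ (M%:R * (2 / 3))); last by rewrite /M natrM; lra.
rewrite exchange_big /=.
apply: le_trans (ler_wpM2l (ler0n _ _) (sum_inv_sqr_le R M.+1)).
rewrite mulr_sumr; apply: ler_sum => d d1.
have dp : 0 < d%:R :> R by rewrite ltr0n ltnW.
rewrite ler_pdivlMr ?exprn_gt0//.
apply: (@le_trans _ _ ((M %/ d ^ 2)%N%:R * d%:R ^+ 2)); last first.
  by rewrite -natrX -natrM ler_nat leq_trunc_div.
rewrite ler_wpM2r ?exprn_ge0//.
rewrite divn_count_dvd -natr_sum ler_nat.
rewrite (big_nat1_ord _ _ xpredT (fun i => (d ^ 2 %| i) : nat)).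
rewrite big_mkcond [leqRHS]big_mkcond; apply: leq_sum => i _ /=.
have [mi|_] := boolP (m < i)%N; last by [].
by rewrite (leq_ltn_trans _ mi).
Qed.

(** At least [5 m] squarefree [q] lie in [(m, 20 m]], and each contributes at least [(20 m)^(-3)]
    because [phi(q) <= q]. *)
Lemma sum_weight_sqr_totient_ge (R : realType) (m M : nat) : (0 < m)%N -> (20 * m <= M)%N ->
  5 / 20 ^+ 3 / m%:R ^+ 2 <=
  \sum_(q < M.+1 | (m < q)%N) weight R q ^+ 2 * (totient q)%:R.
Proof.
move=> m0 mM; have mp : 0 < m%:R :> R by rewrite ltr0n.
have t0 (q : nat) : 0 <= weight R q ^+ 2 * (totient q)%:R.
  by rewrite mulr_ge0// sqr_ge0.
apply: (@le_trans _ _ (\sum_(q < (20 * m).+1 | (m < q)%N) weight R q ^+ 2 * (totient q)%:R)); last first.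
  rewrite (big_ord_widen_cond M.+1 (fun q => m < q)%N
    (fun q => weight R q ^+ 2 * (totient q)%:R))//.
  rewrite big_mkcond [leRHS]big_mkcond; apply: ler_sum => q _ /=.
  by case: (m < q)%N => //=; case: ifP.
apply: (@le_trans _ _ (\sum_(q < (20 * m).+1 | (m < q)%N)
   ((20 * m)%N%:R ^+ 3)^-1 * (squarefree q)%:R)).
  rewrite -mulr_sumr.
  have c0 : 0 <= ((20 * m)%N%:R ^+ 3)^-1 :> R by rewrite invr_ge0 exprn_ge0.
  apply: le_trans (ler_wpM2l c0 (squarefree_count_ge R m m0)).
  rewrite (natrM _ 20 m) le_eqVlt; apply/orP; left; apply/eqP.
  by field; rewrite lt0r_neq0.
apply: ler_sum => q mq.
have q0 : (0 < q)%N by apply: leq_ltn_trans mq.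
have tp : 0 < (totient q)%:R :> R by rewrite ltr0n totient_gt0.
rewrite weight_sqr_totient// sqr_moebius mulrC ler_wpM2l//.
rewrite lef_pV2 ?posrE ?exprn_gt0 ?ltr0n ?muln_gt0//.
rewrite ler_pXn2r ?nnegrE// ler_nat (leq_trans (totient_leq q))//.
  by rewrite -ltnS.
by rewrite totient_gt0.
Qed.

(** * Passage to the limit *)

(** Forget the condition [d | q] in the divisor formula; the resulting bound is uniform in [q],
    which yields convergence for fixed [k]. *)
Lemma ramanujan_sum_norm_le (R : realType) (q k : nat) : (0 < q)%N -> (0 < k)%N ->
  `|complex.Re (ramanujan_sum R q (- k%:Z))| <= \sum_(d <- divisors k) d%:R.
Proof.
move=> q0 k0; pose M := maxn q k.
have qM : (0 < q <= M)%N by rewrite q0 leq_maxl.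
have kM : (0 < k <= M)%N by rewrite k0 leq_maxr.
rewrite (ramanujan_sum_divisors R M q k qM).
rewrite (sum_divisors_ord _ M k (fun d => d%:R) kM).
apply: (le_trans (ler_norm_sum _ _ _)).
rewrite big_mkcond [leRHS]big_mkcond; apply: ler_sum => d _ /=.
case: (d %| q)%N => /=; last by case: ifP.
case: ifP => // _; rewrite normrM normr_nat ler_piMr//.
rewrite -(@ler_pXn2r _ 2) ?nnegrE// expr1n -normrX sqr_moebius.
by case: squarefree; rewrite ?normr1 ?normr0.
Qed.

Lemma truncn_gt0_ge1 (R : realType) (y : R) : 1 <= y -> (0 < Num.truncn y)%N.
Proof. by move=> y1; rewrite truncn_gt_nat. Qed.

Lemma singular_tail_cvg (R : realType) (y : R) (k : nat) : 1 <= y -> (0 < k)%N ->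
  cvgn (fun n => \sum_(1 <= q < n | y < q%:R)
    ((moebius q)%:~R ^+ 2 / (totient q)%:R ^+ 2
      * complex.Re (ramanujan_sum R q (- k%:Z)))).
Proof.
move=> y1 k0; have m0 := truncn_gt0_ge1 R y y1; set m := Num.truncn y in m0.
have y0 : 0 <= y by apply: le_trans y1.
pose C : R := \sum_(d <- divisors k) d%:R.
have C0 : 0 <= C by apply: sumr_ge0.
apply: (cvgn_tail_sum R y (euler_const R * (120 / Num.sqrt m%:R) * C)) => // M.
apply: le_trans (ler_wpM2r C0 (sum_weight_le R M m m0)).
rewrite mulr_suml; apply: ler_sum => q mq.
have q0 : (0 < q)%N by apply: leq_ltn_trans mq.
rewrite normrM (ger0_norm (weight_ge0 R q)) (ler_wpM2l (weight_ge0 R q))//.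
exact: ramanujan_sum_norm_le.
Qed.

Lemma totient_tail_cvg (R : realType) (y : R) : 1 <= y ->
  cvgn (fun n => \sum_(1 <= q < n | y < q%:R)
    ((moebius q)%:~R ^+ 2 / (totient q)%:R ^+ 3 : R)).
Proof.
move=> y1; have m0 := truncn_gt0_ge1 R y y1; set m := Num.truncn y in m0.
have y0 : 0 <= y by apply: le_trans y1.
apply: (cvgn_tail_sum R y (120 * euler_const R / m%:R ^+ 2)) => // M.
apply: le_trans (sum_weight_sqr_totient_le R M m m0).
apply: ler_sum => q mq.
have q0 : (0 < q)%N by apply: leq_ltn_trans mq.
by rewrite weight_sqr_totient// ger0_norm// divr_ge0 ?sqr_ge0.
Qed.

Lemma sum_moebius_totient3_truncn (R : realType) (y : R) (M : nat) : 0 <= y ->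
  \sum_(1 <= q < M.+1 | y < q%:R) ((moebius q)%:~R ^+ 2 / (totient q)%:R ^+ 3 : R) =
  \sum_(q < M.+1 | (Num.truncn y < q)%N) weight R q ^+ 2 * (totient q)%:R.
Proof.
move=> y0; rewrite sum_nat1_truncn//; apply: eq_bigr => q yq.
by rewrite weight_sqr_totient// (leq_ltn_trans _ yq).
Qed.

Lemma totient_tail_le (R : realType) (y : R) : 1 <= y ->
  totient_tail y <= 120 * euler_const R / (Num.truncn y)%:R ^+ 2.
Proof.
move=> y1; have m0 := truncn_gt0_ge1 R y y1.
have y0 : 0 <= y by apply: le_trans y1.
apply: limr_le; first exact: totient_tail_cvg.
apply: nearW => -[|n]; last by rewrite sum_moebius_totient3_truncn// sum_weight_sqr_totient_le.
by rewrite big_geq// divr_ge0 ?exprn_ge0// mulr_ge0// ltW// euler_const_gt0.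
Qed.

Lemma totient_tail_ge (R : realType) (y : R) : 1 <= y ->
  5 / 20 ^+ 3 / (Num.truncn y)%:R ^+ 2 <= totient_tail y.
Proof.
move=> y1; have m0 := truncn_gt0_ge1 R y y1.
have y0 : 0 <= y by apply: le_trans y1.
apply: limr_ge; first exact: totient_tail_cvg.
exists (20 * Num.truncn y).+1 => // -[//|n] /= nM.
by rewrite sum_moebius_totient3_truncn// sum_weight_sqr_totient_ge.
Qed.

(** For fixed [n], finitely many [k] occur, so the truncated difference converges as [M] grows, and
    the bound of [variance_finite] does not depend on [M]. *)
Lemma variance_tail (R : realType) (y : R) (n : nat) : 1 <= y ->
  `|\sum_(1 <= k < n.+1) singular_tail y k ^+ 2 - n%:R * totient_tail y| <=
  offdiag_const R / (Num.truncn y)%:R * Num.sqrt n%:R.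
Proof.
move=> y1; have m0 := truncn_gt0_ge1 R y y1.
have y0 : 0 <= y by apply: le_trans y1.
pose S (k M : nat) : R := \sum_(1 <= q < M | y < q%:R)
    ((moebius q)%:~R ^+ 2 / (totient q)%:R ^+ 2
      * complex.Re (ramanujan_sum R q (- k%:Z))).
pose T (M : nat) : R := \sum_(1 <= q < M | y < q%:R)
    ((moebius q)%:~R ^+ 2 / (totient q)%:R ^+ 3).
pose D M : R := \sum_(1 <= k < n.+1) S k M ^+ 2 - n%:R * T M.
have Dcvg : (D M @[M --> \oo] -->
    \sum_(1 <= k < n.+1) singular_tail y k ^+ 2 - n%:R * totient_tail y)%classic.
  apply: cvgB; last by apply: cvgMr; exact: totient_tail_cvg.
  rewrite big_nat; under eq_fun do rewrite big_nat.
  apply: cvg_big => [|k /andP[k0 _]]; first exact: add_continuous.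
  rewrite expr2; under eq_fun do rewrite expr2.
  by apply: cvgM; apply: singular_tail_cvg.
rewrite -(cvg_lim (@Rhausdorff R) (cvg_norm Dcvg)).
apply: limr_le; first by apply/cvg_ex; eexists; exact: cvg_norm Dcvg.
exists 1%N => // -[//|M] _ /=.
apply: le_trans (variance_finite R M _ n m0).
rewrite /D /T sum_moebius_totient3_truncn// le_eqVlt; apply/orP; left; apply/eqP.
congr (`|_ - _|); apply: eq_big_nat => k _; congr (_ ^+ 2).
rewrite /S sum_nat1_truncn//; apply: eq_bigr => q yq.
have q0 : (0 < q)%N by rewrite (leq_ltn_trans _ yq).
by rewrite (ramanujan_sum_divisors R M)// q0 -ltnS ltn_ord.
Qed.

(** * Real parameters [N] and [y], and the two assertions *)

Lemma variance_asymptotics (R : realType) :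
  exists A a B : R, [/\ 0 < A, 0 < a, 0 < B &
    forall N y : R, 1 <= y -> y <= Num.sqrt N ->
      `|\sum_(1 <= k < (Num.truncn N).+1) singular_tail y k ^+ 2 - N * totient_tail y|
        <= A * (Num.sqrt N / y) /\
      a / y ^+ 2 <= totient_tail y <= B / y ^+ 2].
Proof.
have K0 := euler_const_gt0 R; have O0 := offdiag_const_gt0 R.
(* With [m] the floor of [y], [y <= 2 m] turns 120 into [4 * 120 = 480] in [B] and doubles
   [offdiag_const] below; the summand [B] added there pays for replacing the floor of [N] by [N]. *)
pose a : R := 5 / 20 ^+ 3; pose B : R := 480 * euler_const R.
have a0 : 0 < a by rewrite divr_gt0 ?exprn_gt0.
have B0 : 0 < B by rewrite mulr_gt0.
have A0 : 0 < 2 * offdiag_const R + B by rewrite addr_gt0// mulr_gt0.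
exists (2 * offdiag_const R + B), a, B; split=> // N y y1 yN.
have y0 : 0 < y by apply: lt_le_trans y1.
(* [Num.sqrt] is 0 on nonpositive reals, so [1 <= y <= Num.sqrt N] forces [N > 0]. *)
have sN : 0 < Num.sqrt N by apply: lt_le_trans yN.
have N0 : 0 < N by rewrite -sqrtr_gt0.
have m0 := truncn_gt0_ge1 R y y1; set m := Num.truncn y in m0.
have mp : 0 < m%:R :> R by rewrite ltr0n.
have /andP[my ym] := truncn_itv (ltW y0); rewrite -/m in my ym.
have y2m : y <= 2 * m%:R.
  apply: le_trans (ltW ym) _; rewrite -natr1.
  have : 1 <= m%:R :> R by rewrite ler1n.
  by lra.
have TB : a / y ^+ 2 <= totient_tail y <= B / y ^+ 2.
  apply/andP; split.
    apply: le_trans (totient_tail_ge R y y1).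
    rewrite ler_pM2l// lef_pV2 ?posrE ?exprn_gt0//.
    by rewrite ler_pXn2r ?nnegrE ?(ltW mp) ?(ltW y0).
  apply: (le_trans (totient_tail_le R y y1)); rewrite -/m.
  rewrite ler_pdivlMr ?exprn_gt0// mulrAC ler_pdivrMr ?exprn_gt0//.
  have -> : B * m%:R ^+ 2 = 120 * euler_const R * (2 * m%:R) ^+ 2 by rewrite /B; ring.
  rewrite ler_wpM2l ?mulr_ge0 ?(ltW K0)//.
  by rewrite ler_pXn2r ?nnegrE ?mulr_ge0 ?(ltW y0) ?(ltW mp).
split=> //; have /andP[Ta TB'] := TB.
have T0 : 0 <= totient_tail y by apply: le_trans Ta; rewrite divr_ge0 ?exprn_ge0 ?ltW.
set n := Num.truncn N; have /andP[nN Nn] := truncn_itv (ltW N0); rewrite -/n in nN Nn.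
set S := \sum_(1 <= k < n.+1) _.
have -> : S - N * totient_tail y =
  (S - n%:R * totient_tail y) - (N - n%:R) * totient_tail y by ring.
apply: (le_trans (ler_normB _ _)); rewrite [leRHS]mulrDl; apply: lerD.
  apply: (le_trans (variance_tail R y n y1)); rewrite -/m.
  have -> : offdiag_const R / m%:R * Num.sqrt n%:R =
    offdiag_const R * (Num.sqrt n%:R / m%:R) by ring.
  have -> : 2 * offdiag_const R * (Num.sqrt N / y) =
    offdiag_const R * (2 * Num.sqrt N / y) by ring.
  rewrite (ler_pM2l O0) ler_pdivrMr//.
  apply: (@le_trans _ _ (Num.sqrt N)); first by rewrite ler_wsqrtr.
  have -> : 2 * Num.sqrt N / y * m%:R = Num.sqrt N * (2 * m%:R / y) by ring.
  by rewrite ler_peMr ?(ltW sN)// ler_pdivlMr// mul1r.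
rewrite ger0_norm ?mulr_ge0 ?subr_ge0//.
(* The floor of [N] is off by at most 1, so the error is at most [totient_tail y <= B], and
   [Num.sqrt N / y >= 1]. *)
apply: (@le_trans _ _ (1 * totient_tail y)).
  by rewrite ler_wpM2r// lerBlDr addrC natr1 ltW.
rewrite mul1r; apply: (le_trans TB'); rewrite ler_pM2l//.
apply: (@le_trans _ _ 1).
  by rewrite invf_le1 ?exprn_gt0// exprn_ege1.
by rewrite ler_pdivlMr// mul1r.
Qed.

Theorem corollary1 (R : realType) :
  (exists c : R, 0 < c /\
     exists C : R, 0 < C /\
       forall N y : R, 1 <= y -> y <= c * Num.sqrt N ->
         let S := \sum_(1 <= k < (Num.truncn N).+1) singular_tail y k ^+ 2 in
         `|S| <= C * `|N / y ^+ 2| /\ `|N / y ^+ 2| <= C * `|S|)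
  /\
  (forall delta : R, 0 < delta -> delta < 1 ->
     exists C : R, 0 < C /\
       forall N y : R, 1 <= y -> y <= Num.sqrt N ->
         exists E : R,
           `|E| <= C * (y ^+ 2 / N) `^ (delta / 4) /\
           \sum_(1 <= k < (Num.truncn N).+1) singular_tail y k ^+ 2
             = totient_tail y * N * (1 + E)).
Proof.
have [A [a [B [A0 a0 B0 main]]]] := variance_asymptotics R.
split; last first.
  move=> delta d0 d1; exists (A / a); split=> [|N y y1 yN]; first exact: divr_gt0.
  have [dist /andP[Ta TB]] := main N y y1 yN.
  have y0 : 0 < y by apply: lt_le_trans y1.
  have sN : 0 < Num.sqrt N by apply: lt_le_trans yN.
  have N0 : 0 < N by rewrite -sqrtr_gt0.
  have T0 : 0 < totient_tail y by apply: lt_le_trans Ta; rewrite divr_gt0 ?exprn_gt0.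
  set S := \sum_(1 <= k < _) _ in dist *; set T := totient_tail y in Ta TB T0 dist *.
  (* The relative error is forced, as [T * N > 0]; by the bounds for [S] and [T] it is at most
     [A / a] times the square root of [y^2 / N]. *)
  exists (S / (T * N) - 1); split; last by field; rewrite !lt0r_neq0.
  have Z0 : 0 < y ^+ 2 / N by rewrite divr_gt0 ?exprn_gt0.
  have -> : S / (T * N) - 1 = (S - N * T) / (T * N) by field; rewrite !lt0r_neq0.
  rewrite normrM normfV (gtr0_norm (mulr_gt0 T0 N0)) ler_pdivrMr ?mulr_gt0//.
  apply: (le_trans dist).
  apply: (@le_trans _ _ (A / a * Num.sqrt (y ^+ 2 / N) * (a / y ^+ 2 * N))).
    rewrite sqrtrM ?exprn_ge0 ?(ltW y0)// sqrtr_sqr (gtr0_norm y0) sqrtrV ?(ltW N0)//.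
    rewrite -[X in _ * (_ * X)](sqr_sqrtr (ltW N0)) le_eqVlt; apply/orP; left; apply/eqP.
    by field; rewrite !lt0r_neq0.
  have Aa : 0 < A / a by rewrite divr_gt0.
  apply: ler_pM.
  - by rewrite mulr_ge0 ?sqrtr_ge0 ?(ltW Aa).
  - by rewrite mulr_ge0 ?(ltW N0)// divr_ge0 ?exprn_ge0 ?(ltW a0) ?(ltW y0).
  - rewrite ler_pM2l// -powR12_sqrt ?(ltW Z0)//.
    (* Since [y^2 / N <= 1] and [delta / 4 <= 1 / 2], lowering the exponent only enlarges the
       power. *)
    apply: ger_powR; last by lra.
    rewrite Z0 ler_pdivrMr// mul1r -(sqr_sqrtr (ltW N0)).
    by rewrite ler_pXn2r ?nnegrE ?(ltW y0) ?(ltW sN).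
  - by rewrite ler_wpM2r ?(ltW N0).
(* Taking [c] as the inverse of this number gives [X = Num.sqrt N / y >= 1 + 2 A / a]. The term
   [2 A / a] makes the error [A X] at most half of the main term's lower bound [a X^2]; the 1 gives
   [X <= X^2]. *)
have k0 : 0 < 1 + 2 * A / a by rewrite addr_gt0// divr_gt0// mulr_gt0.
exists (1 + 2 * A / a)^-1; split; first by rewrite invr_gt0.
(* [A + B] serves the upper bound [S <= A X + B X^2], and [2 / a] the lower bound
   [S >= a X^2 / 2]. *)
exists (A + B + 2 / a); split=> [|N y y1 yN]; first by rewrite !addr_gt0// divr_gt0.
move=> S.
have y0 : 0 < y by apply: lt_le_trans y1.
have X1 : 1 + 2 * A / a <= Num.sqrt N / y.
  by rewrite ler_pdivlMr// -ler_pdivlMl.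
have Aa : 0 < A / a by rewrite divr_gt0.
have yN' : y <= Num.sqrt N.
  rewrite -[leLHS]mul1r -ler_pdivlMr//; apply: le_trans X1.
  by rewrite lerDl -mulrA mulr_ge0 ?(ltW Aa).
have sN : 0 < Num.sqrt N by apply: lt_le_trans yN'.
have N0 : 0 < N by rewrite -sqrtr_gt0.
have [dist /andP[Ta TB]] := main N y y1 yN'; rewrite -/S in dist.
have S0 : 0 <= S by apply: sumr_ge0 => k _; apply: sqr_ge0.
have XE : N / y ^+ 2 = (Num.sqrt N / y) ^+ 2 by rewrite exprMn exprVn sqr_sqrtr ?(ltW N0).
set X := Num.sqrt N / y in X1 XE dist.
have X0 : 0 < X by apply: lt_le_trans X1.
rewrite XE (ger0_norm S0) (ger0_norm (sqr_ge0 X)).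
have Tlo : a * X ^+ 2 <= N * totient_tail y.
  by rewrite -XE mulrCA ler_pM2l.
have Thi : N * totient_tail y <= B * X ^+ 2.
  by rewrite -XE mulrCA ler_pM2l.
have X2 : X <= X ^+ 2.
  rewrite expr2 ler_peMr ?(ltW X0)//; apply: le_trans X1.
  by rewrite lerDl -mulrA mulr_ge0 ?(ltW Aa).
have AX : A * X <= A * X ^+ 2 by rewrite ler_pM2l.
have AX2 : 2 * (A * X) <= a * X ^+ 2.
  have -> : 2 * (A * X) = a * (2 * A / a * X) by field; rewrite lt0r_neq0.
  rewrite ler_pM2l// expr2 ler_pM2r//; apply: le_trans X1.
  by rewrite lerDr.
have XX : 0 <= X ^+ 2 := sqr_ge0 X.
have ai : 0 < 2 / a by rewrite divr_gt0.
move: dist; rewrite ler_norml => /andP[lo hi]; split.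
  rewrite !mulrDl.
  have := mulr_ge0 (ltW ai) XX; lra.
apply: (@le_trans _ _ (2 / a * S)).
  rewrite -mulrA -ler_pdivrMl// -ler_pdivrMl ?invr_gt0// invrK.
  lra.
by rewrite ler_wpM2r// lerDr addr_ge0 ?ltW.
Qed.
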